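(* Let $\Pi=(\pi_n)_{n\in\mathbb{N}}$ be a sequence of partitions of $\mathbb{R}_{\ge 0}$ with $|\pi_n|\to 0$, and let $X\in QV(\Pi)$. For admissible integrands $\xi,\eta$ of $X$ and for $A,B\in FV_{\mathrm{loc}}$, define $$Y_t=\int_0^t\xi_{s-}\,dX_s+A_t,\qquad Z_t=\int_0^t\eta_{s-}\,dX_s+B_t .$$ Then the Itô–Föllmer integrals $\int_0^tY_{s-}\,dZ_s$ and $\int_0^tZ_{s-}\,dY_s$ exist and, for all $t\ge0$, $$Y_tZ_t-Y_0Z_0=\int_0^tY_{s-}\,dZ_s+\int_0^tZ_{s-}\,dY_s+[Y,Z]_t .$$
   Context: Conventions. A càdlàg path is a function on $\mathbb{R}_{\ge 0}$ that is right continuous with finite left limits; $X_{0-}=X_0$, $\Delta X_t=X_t-X_{t-}$. A partition is $\pi=(t_i)_{i\in\mathbb{N}}$ with $0=t_0<t_1<\cdots\to\infty$, and $|\pi|=\sup_i|t_{i+1}-t_i|$. Quadratic variation. A real càdlàg path $X$ has quadratic variation along $\Pi=(\pi_n)$ if $t\mapsto\sum_{t_i\in\pi_n}(X_{t_{i+1}\wedge t}-X_{t_i\wedge t})^2$ converges pointwise to a càdlàg increasing function $[X,X]$ with $\Delta[X,X]_t=(\Delta X_t)^2$ for all $t\ge0$. An $\mathbb{R}^d$-valued càdlàg path $X$ has quadratic variation along $\Pi$ if $X^i+X^j$ does for all $i,j$. $QV(\Pi;\mathbb{R}^d)$ is the set of such paths, $QV(\Pi)=QV(\Pi;\mathbb{R})$.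 For $(Y,Z)\in QV(\Pi;\mathbb{R}^2)$, $[Y,Z]=\frac12([Y+Z,Y+Z]-[Y,Y]-[Z,Z])$. $FV_{\mathrm{loc}}$ is the set of real càdlàg paths of locally finite variation. Itô–Föllmer integral. For real càdlàg $\xi$ and $X$, $\int_0^t\xi_{s-}\,dX_s:=\lim_{n\to\infty}\sum_{t_i\in\pi_n}\xi_{t_i}(X_{t_{i+1}\wedge t}-X_{t_i\wedge t})$; it is said to exist if this limit exists and is finite. Admissible integrands. A function $f(a,x)$ on an open $U\subset\mathbb{R}^m\times\mathbb{R}$ is of class $C^{1,2}$ if it is once continuously differentiable in $a$ and twice in $x$, with all these derivatives continuous in $(a,x)$ jointly. A real càdlàg path $\xi$ is an admissible integrand of $X\in QV(\Pi)$ if for any $T>0$ there exist $m\in\mathbb{N}$, an open $U\subset\mathbb{R}^m\times\mathbb{R}$, a real function $f$ of class $C^{1,2}$ on $U$, and $A\in FV_{\mathrm{loc}}^m$ such that $\xi_t=\frac{\partial f}{\partial x}(A_t,X_t)$ for all $t\in[0,T]$ and the image of $[0,T]\ni t\mapsto(A_t,X_t)\in U$ is relatively compact in $U$. For an admissible integrand $\xi$ of $X$ the integral $\int_0^t\xi_{s-}\,dX_s$ exists for all $t\ge0$. *)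

(* Defs.v *)
From HB Require Import structures.
From mathcomp Require Import all_boot all_order all_algebra.
From mathcomp Require Import all_classical all_reals all_analysis.

Set Implicit Arguments.
Unset Strict Implicit.
Unset Printing Implicit Defensive.

Import Order.TTheory GRing.Theory Num.Theory.
Import numFieldNormedType.Exports.

Local Open Scope classical_set_scope.
Local Open Scope ring_scope.

(* A path on the half-line t >= 0 is represented by a total function R -> R;
   its values at negative times are never constrained and never used. *)

Definition cadlag (R : realType) (X : R -> R) : Prop :=
  (forall t : R, 0 <= t -> X s @[s --> t^'+] --> X t) /\
  (forall t : R, 0 < t -> cvg (X s @[s --> t^'-])).

Definition left_limit (R : realType) (X : R -> R) (t : R) : R :=
  if 0 < t then lim (X s @[s --> t^'-]) else X 0.

Definition jump (R : realType) (X : R -> R) (t : R) : R :=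
  X t - left_limit X t.

Definition is_partition (R : realType) (p : nat -> R) : Prop :=
  [/\ p 0%N = 0, (forall i, p i < p i.+1) & p i @[i --> \oo] --> +oo].

(* The mesh may be infinite, hence the extended real value. *)
Definition mesh (R : realType) (p : nat -> R) : \bar R :=
  ereal_sup (range (fun i => `|p i.+1 - p i|%:E)).

(* The series below have only finitely many nonzero terms when p is a
   partition, since p i >= t for all large i. *)
Definition qv_sum (R : realType) (p : nat -> R) (X : R -> R) (t : R) : R :=
  limn (series (fun i => (X (Num.min (p i.+1) t) - X (Num.min (p i) t)) ^+ 2)).

Definition ito_sum (R : realType) (p : nat -> R) (xi X : R -> R) (t : R) : R :=
  limn (series
    (fun i => xi (p i) * (X (Num.min (p i.+1) t) - X (Num.min (p i) t)))).

Definition bracket (R : realType) (Pi : nat -> nat -> R) (X : R -> R) (t : R)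
    : R :=
  limn (fun n => qv_sum (Pi n) X t).

Definition QV (R : realType) (Pi : nat -> nat -> R) (X : R -> R) : Prop :=
  [/\ cadlag X,
      (forall t : R, 0 <= t -> cvgn (fun n => qv_sum (Pi n) X t)),
      cadlag (bracket Pi X),
      (forall s t : R, 0 <= s -> s <= t -> bracket Pi X s <= bracket Pi X t)
    & (forall t : R, 0 <= t -> jump (bracket Pi X) t = jump X t ^+ 2)].

(* Paths with values in R^d are given by their d components. *)
Definition QVd (R : realType) (Pi : nat -> nat -> R) (d : nat)
    (X : 'I_d -> R -> R) : Prop :=
  (forall i, cadlag (X i)) /\ (forall i j, QV Pi (X i \+ X j)).

Definition covariation (R : realType) (Pi : nat -> nat -> R) (Y Z : R -> R)
    (t : R) : R :=
  2^-1 * (bracket Pi (Y \+ Z) t - bracket Pi Y t - bracket Pi Z t).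

Definition FVloc (R : realType) (A : R -> R) : Prop :=
  cadlag A /\ (forall T : R, 0 < T -> bounded_variation 0 T A).

Definition ito_integral_exists (R : realType) (Pi : nat -> nat -> R)
    (xi X : R -> R) (t : R) : Prop :=
  cvgn (fun n => ito_sum (Pi n) xi X t).

Definition ito_integral (R : realType) (Pi : nat -> nat -> R)
    (xi X : R -> R) (t : R) : R :=
  limn (fun n => ito_sum (Pi n) xi X t).

Definition partial_a (R : realType) (m : nat) (i : 'I_m)
    (f : 'rV[R]_m * R -> R) (p : 'rV[R]_m * R) : R :=
  'D_(delta_mx 0 i) (fun a => f (a, p.2)) p.1.

Definition partial_x (R : realType) (m : nat)
    (f : 'rV[R]_m * R -> R) (p : 'rV[R]_m * R) : R :=
  derive1 (fun x => f (p.1, x)) p.2.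

(* f is a total function, but only its restriction to the open set U matters. *)
Definition C12 (R : realType) (m : nat) (U : set ('rV[R]_m * R))
    (f : 'rV[R]_m * R -> R) : Prop :=
  forall p, U p ->
    [/\ (forall i : 'I_m,
           derivable (fun a => f (a, p.2)) p.1 (delta_mx 0 i) /\
           {for p, continuous (partial_a i f)}),
        derivable (fun x => f (p.1, x)) p.2 1,
        {for p, continuous (partial_x f)},
        derivable (fun x => partial_x f (p.1, x)) p.2 1
      & {for p, continuous (partial_x (partial_x f))}].

(* S is a subset of U whose closure relative to U is compact. *)
Definition relatively_compact_in (T : topologicalType) (U S : set T) : Prop :=
  S `<=` U /\ compact (closure S `&` U).

Definition admissible_integrand (R : realType) (xi X : R -> R) : Prop :=
  cadlag xi /\
  forall T : R, 0 < T ->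
    exists (m : nat) (U : set ('rV[R]_m * R)) (f : 'rV[R]_m * R -> R)
           (A : 'I_m -> R -> R),
      let AX := fun t => (\row_i A i t, X t) in
      [/\ open U, C12 U f, (forall i, FVloc (A i)),
          (forall t : R, 0 <= t <= T -> xi t = partial_x f (AX t))
        & relatively_compact_in U (AX @` [set t | 0 <= t <= T])].

(* Main.v *)
Require Import Defs.
From mathcomp Require Import all_boot all_order all_algebra.
From mathcomp Require Import all_classical all_reals all_analysis.
From mathcomp Require Import ring lra.
Import Order.TTheory GRing.Theory Num.Theory.
Import numFieldNormedType.Exports.
Local Open Scope classical_set_scope.
Local Open Scope ring_scope.

(** The argument is local in time.  The times before [tau] and those from [tau]
    on are treated separately, because on a short enough one-sided
    neighbourhood every cadlag path is almost constant; the intervals of the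
    partition that straddle a given time contribute only a jump term, whose
    limit is known from the one-sided limits.

    Sewing.  Consider sums [sum E(t_i, t_(i+1))] with the germ
    [E(s,t) = xi_s (Z_t - Z_s)].  Suppose that, on each side of each time and
    for each [e > 0], the germ is of the form
    [K_t - K_s + c (X_t - X_s)^2], up to an error of at most
    [e (a_t - a_s + (X_t - X_s)^2)] with [a] a fixed increasing cadlag path
    ([locally_approx]).  The increments of [K] telescope, the squares sum to
    the quadratic variation of [X], and the sum of the errors is bounded in
    the limit by [e] times an increment of [a + [X,X]].  A supremum
    argument along the time axis glues these local statements together: the
    sums are Cauchy ([ito_integral_exists_local]).  The same estimate
    shows that the integral is cadlag with jumps [xi_(t-) (Z_t - Z_(t-))]
    ([ito_regular_local]), and that it differs from [K], locally, by a
    path dominated by [a + [X,X]] ([ito_integral_local]).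

    Fields.  Near [tau] an admissible integrand is [xi_s = phi_s'(X_s)] where
    [phi_s(x) = f(A_s, x)] lives on a fixed ball around the one-sided limit
    [x0] of [X]; a [local_field] records the estimates on [phi] that are used,
    and forgets the finite-dimensional path [A].  A Taylor expansion shows that
    [xi_s (X_t - X_s)] is locally approximated with [K_t = phi_t(X_t) - L_t],
    which is Ito's formula in germ form ([germ_approx_of_field]).  Hence
    [int xi dX] exists, and [Y = int xi dX + A] is again of the form
    [Y_s = phi_s(X_s) + C_s] with [C] dominated by an increasing path
    ([has_path_fields_of_integral]).

    The integral of [Y] against [Z].  With [Y_s = phi_s(X_s)] and
    [Z_s = gam_s(X_s)] the germ [Y_s (Z_t - Z_s)] is
    [(phi_s gam_s')(X_s) (X_t - X_s)] plus terms with an immediate local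
    approximation.  The point is that [Y eta], where [eta] is the integrand of
    [Z], has a field as well, namely the primitive [h_s] of [phi_s gam_s'] that
    vanishes at [x0].  No derivative of [gam_s'] in time is
    available, but an integration by parts moves the time increment from
    [gam_s'] to [gam_s], so that [h] depends on time as regularly as [phi] and
    [gam] do ([local_field_mul]).  So all the integrals [int Y dZ], [int Z dY],
    [int Y dY], [int Z dZ] exist and are cadlag with the expected jumps.

    Conclusion.  The identity
    [(W_t - W_s)^2 = W_t^2 - W_s^2 - 2 W_s (W_t - W_s)] turns the existence of
    [int W dW] into the existence of the quadratic variation of [W], with
    [[W,W] = W^2 - W_0^2 - 2 int W dW] ([QV_of_ito_regular]); applied to [Y],
    [Z] and [Y + Z] and polarized, it is the integration by parts formula. *)

(** * One-sided neighbourhoods and cadlag paths *)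

(** These are the sets on which a cadlag path is close to a single value; right
    continuity is the reason why the right ones contain [t] and the left ones
    do not.  As negative times are excluded, the left neighbourhoods of [0] are
    empty and need no special case. *)
Definition half_nbhd {R : realType} (b : bool) (t d : R) : set R :=
  [set s | 0 <= s /\ if b then t <= s < t + d else t - d < s < t].

Definition half_nbhds {R : realType} (b : bool) (t : R) : set_system R :=
  filter_from [set d | 0 < d] (half_nbhd b t).

(** The one-sided limit of a cadlag path; being right continuous, its limit
    from the right is its value. *)
Definition side_value {R : realType} (b : bool) (F : R -> R) (t : R) : R :=
  if b then F t else left_limit F t.

Lemma half_nbhd_le {R : realType} {b} {t d e : R} : d <= e ->
  half_nbhd b t d `<=` half_nbhd b t e.
Proof.
by move=> de s []; case: b => s0 /andP[s1 s2]; split=> //; apply/andP; split; lra.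
Qed.

Global Instance half_nbhds_filter {R : realType} b (t : R) :
  Filter (half_nbhds b t).
Proof.
apply: filter_from_filter; first by exists 1 => /=.
move=> d e /= d0 e0; exists (Num.min d e) => /=; first by rewrite lt_min d0.
by rewrite subsetI; split; apply: half_nbhd_le; rewrite ge_min lexx ?orbT.
Qed.

Lemma half_nbhds_proper {R : realType} b {t : R} :
  (if b then 0 <= t else 0 < t) -> ProperFilter (half_nbhds b t).
Proof.
move=> t0; apply: filter_from_proper => d /= d0.
case: b t0 => t0; first by exists t; split=> //; lra.
exists (Num.max (t / 2) (t - d / 2)); split.
  by rewrite le_max; apply/orP; left; lra.
rewrite lt_max gt_max; apply/andP; split; first by apply/orP; right; lra.
by apply/andP; split; lra.
Qed.

Lemma half_nbhds_right {R : realType} (F : R -> R) {t : R} : 0 <= t ->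
  F s @[s --> t^'+] --> F t <-> F s @[s --> half_nbhds true t] --> F t.
Proof.
move=> t0; split=> [/cvgrPdist_lt H|/cvgrPdist_lt H]; apply/cvgrPdist_lt => e e0.
  have [d /= d0 Hd] := H _ e0; exists d => //= s [s0 /andP[]].
  rewrite le_eqVlt => /predU1P[<-|ts] sd; first by rewrite subrr normr0.
  by apply: Hd => //=; rewrite distrC gtr0_norm ?subr_gt0// ltrBlDl.
have [d /= d0 Hd] := H _ e0; exists d => //= s /= sd ts.
apply: Hd; split; first exact: (le_trans t0 (ltW ts)).
by move: sd; rewrite distrC gtr0_norm ?subr_gt0// => sd; apply/andP; split; lra.
Qed.

Lemma half_nbhds_left {R : realType} (F : R -> R) {t : R} (l : R) : 0 < t ->
  F s @[s --> t^'-] --> l <-> F s @[s --> half_nbhds false t] --> l.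
Proof.
move=> t0; split=> [/cvgrPdist_lt H|/cvgrPdist_lt H]; apply/cvgrPdist_lt => e e0.
  have [d /= d0 Hd] := H _ e0; exists d => //= s [s0 /andP[sd ts]].
  by apply: Hd => //=; rewrite gtr0_norm ?subr_gt0//; lra.
have [d /= d0 Hd] := H _ e0.
exists (Num.min d t) => /=; first by rewrite lt_min d0.
move=> s /=; rewrite lt_min => /andP[sd st] ts; apply: Hd.
move: sd st; rewrite gtr0_norm ?subr_gt0// => sd st.
by split; [lra|apply/andP; split; lra].
Qed.

Lemma cadlag_cvg {R : realType} {F : R -> R} b {t : R} : cadlag F -> 0 <= t ->
  F s @[s --> half_nbhds b t] --> side_value b F t.
Proof.
move=> [Fr Fl] t0; case: b; first exact/half_nbhds_right/Fr.
rewrite /side_value /left_limit; case: ifPn => [tgt0|tle0].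
  by apply/(half_nbhds_left F _ tgt0); exact: Fl.
apply/cvgrPdist_lt => e e0; exists 1 => //= s [s0 /andP[_ st]]; lra.
Qed.

Lemma left_limit_cvg {R : realType} {F : R -> R} {t l : R} : 0 < t ->
  F s @[s --> half_nbhds false t] --> l -> left_limit F t = l.
Proof.
move=> t0 /half_nbhds_left Fl; rewrite /left_limit t0.
by apply/cvg_lim => //; exact: Fl.
Qed.

Lemma cadlag_of_cvg {R : realType} {F : R -> R} :
  (forall t, 0 <= t -> F s @[s --> half_nbhds true t] --> F t) ->
  (forall t, 0 < t -> exists l : R, F s @[s --> half_nbhds false t] --> l) ->
  cadlag F.
Proof.
move=> Fr Fl; split=> t t0; first exact/half_nbhds_right/Fr.
by have [l Fl'] := Fl _ t0; apply/cvg_ex; exists l; apply/half_nbhds_left.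
Qed.

Lemma half_nbhds_ge0 {R : realType} b (t : R) :
  \forall s \near half_nbhds b t, 0 <= s.
Proof. by exists 1 => //= s []. Qed.

Lemma cadlag_ext {R : realType} {F G : R -> R} :
  (forall t, 0 <= t -> F t = G t) -> cadlag F -> cadlag G.
Proof.
move=> FG Fc; have FG' b t : {near half_nbhds b t, F =1 G}.
  by apply: filterS (half_nbhds_ge0 b t) => s s0; exact: FG.
apply: cadlag_of_cvg => t t0.
  rewrite -FG//; apply: cvg_trans (cadlag_cvg true Fc t0).
  by apply: near_eq_cvg; exact: FG'.
exists (left_limit F t); apply: cvg_trans (cadlag_cvg false Fc (ltW t0)).
by apply: near_eq_cvg; exact: FG'.
Qed.

Lemma left_limit_ext {R : realType} {F G : R -> R} {t : R} :
  (forall t, 0 <= t -> F t = G t) -> cadlag F -> 0 <= t ->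
  left_limit F t = left_limit G t.
Proof.
move=> FG Fc; rewrite le_eqVlt => /predU1P[<-|t0].
  by rewrite /left_limit ltxx FG.
apply/esym/left_limit_cvg => //.
apply: cvg_trans (cadlag_cvg false Fc (ltW t0)).
by apply: near_eq_cvg; apply: filterS (half_nbhds_ge0 false t) => s s0; exact: FG.
Qed.

(** Sums and products of paths are treated at once: all that matters is that
    the operation is compatible with limits along one-sided neighbourhoods. *)
Lemma cadlag_lift2 {R : realType} (op : R -> R -> R) {F G : R -> R} :
  (forall b (t x y : R), F s @[s --> half_nbhds b t] --> x ->
     G s @[s --> half_nbhds b t] --> y ->
     op (F s) (G s) @[s --> half_nbhds b t] --> op x y) ->
  cadlag F -> cadlag G ->
  cadlag (fun t => op (F t) (G t)) /\
  forall t, 0 <= t -> left_limit (fun t => op (F t) (G t)) t =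
                      op (left_limit F t) (left_limit G t).
Proof.
move=> opc Fc Gc.
have H b t : 0 <= t -> op (F s) (G s) @[s --> half_nbhds b t] -->
    op (side_value b F t) (side_value b G t).
  by move=> t0; apply: opc; exact: cadlag_cvg.
split; first (apply: cadlag_of_cvg => t t0; first exact: (H true)).
  by exists (op (left_limit F t) (left_limit G t)); exact: (H false _ (ltW t0)).
move=> t; rewrite le_eqVlt => /predU1P[<-|t0]; first by rewrite /left_limit ltxx.
by apply: left_limit_cvg => //; exact: (H false _ (ltW t0)).
Qed.

Lemma cadlag_add {R : realType} {F G : R -> R} : cadlag F -> cadlag G ->
  cadlag (F \+ G) /\ forall t, 0 <= t ->
   left_limit (F \+ G) t = left_limit F t + left_limit G t.
Proof.
move=> Fc Gc; apply: (cadlag_lift2 +%R) => // b t x y; exact: cvgD.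
Qed.

Lemma cadlag_mul {R : realType} {F G : R -> R} : cadlag F -> cadlag G ->
  cadlag (F \* G) /\ forall t, 0 <= t ->
   left_limit (F \* G) t = left_limit F t * left_limit G t.
Proof.
move=> Fc Gc; apply: (cadlag_lift2 *%R) => // b t x y; exact: cvgM.
Qed.

Lemma cadlag_cst {R : realType} (c : R) : cadlag (fun _ => c) /\
  forall t, left_limit (fun _ => c) t = c.
Proof.
split; first by apply: cadlag_of_cvg => t t0; [|exists c]; exact: cvg_cst.
move=> t; rewrite /left_limit; case: ifPn => // t0.
by apply/cvg_lim => //; exact: cvg_cst.
Qed.

(** A two-sided bound, from the two one-sided limits; it controls the value at
    the last partition point before [t], which may lie on either side. *)
Lemma cadlag_bounded {R : realType} {F : R -> R} {t : R} : cadlag F -> 0 <= t ->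
  exists2 d, 0 < d & exists2 M, 0 < M &
    forall s, 0 <= s -> `|s - t| < d -> `|F s| <= M.
Proof.
move=> Fc t0.
have [d1 /= d10 H1] : \forall s \near half_nbhds true t, `|F t - F s| < 1.
  by have /cvgrPdist_lt /(_ _ ltr01) := cadlag_cvg true Fc t0.
have [d2 /= d20 H2] : \forall s \near half_nbhds false t, `|left_limit F t - F s| < 1.
  by have /cvgrPdist_lt /(_ _ ltr01) := cadlag_cvg false Fc t0.
exists (Num.min d1 d2); first by rewrite lt_min d10.
exists (`|F t| + `|left_limit F t| + 1); first by rewrite ltr_wpDl// addr_ge0.
move=> s s0; rewrite lt_min => /andP[sd1 sd2].
have n1 := normr_ge0 (F t); have n2 := normr_ge0 (left_limit F t).
have [ts|st] := leP t s.
  have : `|F t - F s| < 1.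
    apply: H1; split => //; move: sd1; rewrite ger0_norm ?subr_ge0// => ?.
    by apply/andP; split; lra.
  by rewrite distrC => /ltW /(le_trans (lerB_dist _ _)) => ?; lra.
have : `|left_limit F t - F s| < 1.
  apply: H2; split => //; move: sd2; rewrite ltr0_norm ?subr_lt0// => ?.
  by apply/andP; split; lra.
by rewrite distrC => /ltW /(le_trans (lerB_dist _ _)) => ?; lra.
Qed.

(** * Sums along a partition *)

(** The common form of the sums defining quadratic variations and integrals;
    clipping both arguments at [t] makes the splitting lemma below apply to
    both. *)
Definition germ_sum {R : realType} (p : nat -> R) (E : R -> R -> R) (t : R) : R :=
  limn (series (fun i => E (Num.min (p i) t) (Num.min (p i.+1) t))).

Definition ito_germ {R : realType} (xi Z : R -> R) (s t : R) : R :=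
  xi s * (Z t - Z s).

Definition sqr_germ {R : realType} (Z : R -> R) (s t : R) : R :=
  (Z t - Z s) ^+ 2.

Lemma mesh_lt {R : realType} {Pi : nat -> nat -> R} {d : R} :
  mesh (Pi n) @[n --> \oo] --> 0%E -> 0 < d ->
  \forall n \near \oo, forall i, Pi n i.+1 - Pi n i < d.
Proof.
move=> hmesh d0.
have H : nbhs (0%E : \bar R) [set x | (x < d%:E)%E].
  have := @nbhs_open_ereal_lt R 0 (fun=> d) d0; exact.
have [N _ HN] := hmesh _ H; exists N => //= n Nn i; have {HN Nn} Hn := HN n Nn.
rewrite -lte_fin; apply: le_lt_trans Hn.
apply: (@le_trans _ _ `|Pi n i.+1 - Pi n i|%:E).
  by rewrite lee_fin ler_norm.
by apply: ereal_sup_ubound; exists i.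
Qed.

Lemma partition_le {R : realType} {p : nat -> R} {i j} : is_partition p ->
  (i <= j)%N -> p i <= p j.
Proof.
move=> [_ pS _]; elim: j => [|j IH]; first by rewrite leqn0 => /eqP ->.
rewrite leq_eqVlt => /predU1P[->//|]; rewrite ltnS => /IH h.
exact: le_trans h (ltW (pS j)).
Qed.

Lemma partition_ge0 {R : realType} {p : nat -> R} i : is_partition p -> 0 <= p i.
Proof. by move=> hp; have [<- _ _] := hp; exact: partition_le. Qed.

Lemma partition_unbounded {R : realType} {p : nat -> R} t : is_partition p ->
  exists N, t < p N.
Proof.
move=> [_ _ /cvgryPgt /(_ t)]; case=> N _ /(_ N) /=.
by move=> /(_ (leqnn _)); exists N.
Qed.

Lemma partition_right {R : realType}
    {p : nat -> R} {s} : is_partition p -> 0 <= s ->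
  exists k, p k <= s < p k.+1.
Proof.
move=> hp s0; case: (ex_minnP (partition_unbounded s hp)) => -[|k] sk kmin.
  by have [p0 _ _] := hp; move: sk; rewrite p0 ltNge s0.
exists k; rewrite sk andbT leNgt; apply/negP => /kmin; rewrite ltnn //.
Qed.

Lemma partition_left {R : realType}
    {p : nat -> R} {t} : is_partition p -> 0 < t ->
  exists l, p l < t <= p l.+1.
Proof.
move=> hp t0.
have ex : exists N, t <= p N.
  by have [N /ltW] := partition_unbounded t hp; exists N.
case: (ex_minnP ex) => -[|k] sk kmin.
  by have [p0 _ _] := hp; move: sk; rewrite p0 leNgt t0.
exists k; rewrite sk andbT ltNge; apply/negP => /kmin; rewrite ltnn //.
Qed.

Lemma germ_sum_series {R : realType} {p : nat -> R} {E : R -> R -> R}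
    {t : R} {N} :
  is_partition p -> E t t = 0 -> t <= p N ->
  series (fun i => E (Num.min (p i) t) (Num.min (p i.+1) t)) @ \oo -->
  \sum_(0 <= i < N) E (Num.min (p i) t) (Num.min (p i.+1) t).
Proof.
move=> hp Ett tN; apply: cvg_near_cst; exists N => //= m /= Nm.
rewrite seriesEnat /= (big_cat_nat (n := N))//= -[RHS]addr0; congr (_ + _).
rewrite big_nat_cond big1//.
move=> i /andP[/andP[Ni im] _].
have h j : (N <= j)%N -> Num.min (p j) t = t.
  by move=> Nj; apply/min_idPr/(le_trans tN)/partition_le.
by rewrite !h// (leq_trans Ni).
Qed.

Lemma germ_sumE {R : realType} {p : nat -> R} {E : R -> R -> R} {t : R} N :
  is_partition p -> E t t = 0 -> t <= p N ->
  germ_sum p E t = \sum_(0 <= i < N) E (Num.min (p i) t) (Num.min (p i.+1) t).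
Proof. by move=> hp Ett tN; apply/cvg_lim => //; exact: germ_sum_series. Qed.

(** An integrand is evaluated at [p i] and not at the clipped time, but where the
    two differ the increment of the integrator is zero. *)
Lemma ito_sumE {R : realType} {p : nat -> R} (xi Z : R -> R) :
  is_partition p -> ito_sum p xi Z = germ_sum p (ito_germ xi Z).
Proof.
move=> hp; apply/funext => t; rewrite /ito_sum /germ_sum; congr (limn (series _)).
apply/funext => i; rewrite /ito_germ; have [//|/ltW ti] := leP (p i) t.
have -> : Num.min (p i.+1) t = t.
  by apply/min_idPr/(le_trans ti)/partition_le.
by rewrite !subrr !mulr0.
Qed.

Lemma qv_sumE {R : realType} (p : nat -> R) (Z : R -> R) :
  qv_sum p Z = germ_sum p (sqr_germ Z).
Proof. by []. Qed.

Lemma germ_sum0 {R : realType} {p : nat -> R} {E : R -> R -> R} :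
  is_partition p -> E 0 0 = 0 -> germ_sum p E 0 = 0.
Proof.
move=> hp E0; rewrite (germ_sumE 0%N)// ?big_nil//.
exact: partition_ge0.
Qed.

(** The indices [k] and [l] depend on the partition only, so that sums of several
    germs can be compared term by term.  Between [s] and [t] three kinds of
    terms remain: the interval straddling [s], the intervals inside [(s, t)],
    and the piece that ends at [t]. *)
Lemma germ_sum_split {R : realType} {p : nat -> R} {s t d : R} :
  is_partition p -> 0 <= s -> (forall i, p i.+1 - p i < d) -> d <= t - s ->
  exists k l, [/\ p k <= s < p k.+1, (k.+1 <= l)%N, p l < t <= p l.+1 &
   forall E : R -> R -> R, E s s = 0 -> E t t = 0 -> germ_sum p E t - germ_sum p E s =
     (E (p k) (p k.+1) - E (p k) s) + \sum_(k.+1 <= i < l) E (p i) (p i.+1)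
     + E (p l) t].
Proof.
move=> hp s0 hd dts.
have d0 : 0 < d by have [_ /(_ 0%N) + _] := hp; have := hd 0%N; lra.
have [k /andP[ks sk]] := partition_right hp s0.
have [l /andP[lt tl]] : exists l, p l < t <= p l.+1.
  by apply: partition_left => //; lra.
have kl : (k < l)%N.
  rewrite ltnNge; apply/negP => lk.
  by have := partition_le hp lk; have := hd l; lra.
exists k, l; split; [by rewrite ks|by []|by rewrite lt|] => E Es Et.
rewrite (germ_sumE l.+1)// (germ_sumE k.+1)//; last exact: ltW.
rewrite !big_nat_recr//= (big_cat_nat (n := k.+1))//= big_nat_recr//=.
have pl i : (i <= l)%N -> Num.min (p i) t = p i.
  by move=> il; apply/min_idPl/ltW/(le_lt_trans _ lt)/partition_le.
have pk i : (i <= k)%N -> Num.min (p i) s = p i.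
  by move=> ik; apply/min_idPl/(le_trans _ ks)/partition_le.
rewrite (pl l)// (pl k) ?(ltnW kl)// (pl k.+1)// (min_idPr tl) (pk k)//.
rewrite (min_idPr (ltW sk)).
have -> : \sum_(k.+1 <= i < l) E (Num.min (p i) t) (Num.min (p i.+1) t) =
    \sum_(k.+1 <= i < l) E (p i) (p i.+1).
  by apply: eq_big_nat => i /andP[_ il]; rewrite !pl// ltnW.
have -> : \sum_(0 <= i < k) E (Num.min (p i) t) (Num.min (p i.+1) t) =
    \sum_(0 <= i < k) E (Num.min (p i) s) (Num.min (p i.+1) s).
  apply: eq_big_nat => i /andP[_ il].
  have il' : (i.+1 <= l)%N by exact: ltn_trans kl.
  by rewrite !pk ?pl// ltnW.
by ring.
Qed.

(** * Local approximation of germs *)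

Definition increasing_path {R : realType} (a : R -> R) : Prop :=
  cadlag a /\ forall s t, 0 <= s -> s <= t -> a s <= a t.

(** The germs [K t - K s] and [(X t - X s) ^+ 2] are the ones whose sums are
    known to converge; the second condition makes [K] right continuous and
    gives it left limits. *)
Definition germ_approx {R : realType} (X a : R -> R) (E : R -> R -> R)
    (I : set R) (e : R) (K : R -> R) (c M : R) : Prop :=
  (forall s t, I s -> I t -> s <= t ->
     `|E s t - (K t - K s) - c * (X t - X s) ^+ 2|
       <= e * (a t - a s + (X t - X s) ^+ 2)) /\
  (forall s t, I s -> I t -> s <= t ->
     `|K t - K s| <= M * (`|X t - X s| + (a t - a s))).

Definition locally_approx {R : realType} (X a : R -> R) (E : R -> R -> R)
    (t : R) : Prop :=
  forall (b : bool) (e : R), 0 < e -> exists2 d, 0 < d & exists K c M,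
    0 <= M /\ germ_approx X a E (half_nbhd b t d) e K c M.

Lemma germ_approx_inner {R : realType} {X a : R -> R} {E} {I : set R} {e : R}
    {K : R -> R} {c M : R} (p : nat -> R) m l :
  germ_approx X a E I e K c M -> (forall i, p i <= p i.+1) ->
  (m <= l)%N -> (forall i, (m <= i <= l)%N -> I (p i)) ->
  `|\sum_(m <= i < l) E (p i) (p i.+1) - (K (p l) - K (p m))
    - c * \sum_(m <= i < l) sqr_germ X (p i) (p i.+1)|
  <= e * (a (p l) - a (p m) + \sum_(m <= i < l) sqr_germ X (p i) (p i.+1)).
Proof.
move=> [EK _] pS ml pI.
rewrite -(telescope_sumr (fun i => K (p i)))// -(telescope_sumr (fun i => a (p i)))//.
rewrite [c * _]mulr_sumr -!sumrB -big_split/= mulr_sumr.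
apply: le_trans (ler_norm_sum _ _ _) _; apply: ler_sum_nat => i /andP[mi il].
by apply: EK => //; apply: pI; rewrite ?mi/= ?(ltnW il)// ?il ?leqW//.
Qed.

Lemma cvg_dist_near {T : Type} {F : set_system T} {FF : Filter F} {R : realType}
    {f : T -> R} {l e : R} : f @ F --> l -> 0 < e -> \forall x \near F, `|f x - l| < e.
Proof.
by move=> /cvgrPdist_lt /[apply]; apply: filterS => x; rewrite distrC.
Qed.

Lemma norm_le_of_bounds {R : realType} {x y : R} : -y <= x -> x <= y -> `|x| <= y.
Proof. by move=> h1 h2; rewrite ler_norml h1. Qed.

Lemma norm_le_sum4 {R : realType} {x1 x2 x3 x4 b1 b2 b3 b4 b : R} :
  `|x1| <= b1 -> `|x2| <= b2 -> `|x3| <= b3 -> `|x4| <= b4 ->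
  b1 + b2 + b3 + b4 <= b -> `|x1 + x2 + x3 - x4| <= b.
Proof.
rewrite !ler_norml => /andP[? ?] /andP[? ?] /andP[? ?] /andP[? ?] ?.
by apply/andP; split; lra.
Qed.

(** The last partition point [v] before [t] is kept explicit, because the germ
    may jump at [t]: so [I] need only contain the times from [s] up to [t],
    [t] excluded, and one estimate serves both the right neighbourhoods of [s]
    and the left neighbourhoods of [t].  The term straddling [s] disappears by
    right continuity at [s]. *)
Lemma ito_sum_increment {R : realType} {Pi : nat -> nat -> R}
    {X a xi Z : R -> R} {I : set R} {e : R} {K : R -> R} {c M s t h : R} :
  (forall n, is_partition (Pi n)) -> mesh (Pi n) @[n --> \oo] --> 0%E ->
  QV Pi X -> increasing_path a -> cadlag xi -> cadlag Z -> 0 <= e -> 0 <= M ->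
  germ_approx X a (ito_germ xi Z) I e K c M ->
  0 <= s -> s < t -> (forall u, s <= u < t -> I u) -> 0 < h ->
  \forall n \near \oo, exists v, [/\ t - h < v, s <= v, v < t &
    `|ito_sum (Pi n) xi Z t - ito_sum (Pi n) xi Z s - ito_germ xi Z v t
      - (K v - K s)
      - c * (bracket Pi X t - bracket Pi X s - (X t - X v) ^+ 2)|
    <= e * (a v - a s + (bracket Pi X t - bracket Pi X s - (X t - X v) ^+ 2))
       + h].
Proof.
move=> hPi hmesh [Xc Xcv _ _ _] [ac ainc] xic Zc e0 M0 app s0 st sI h0.
have [d1 d10 [M1 M10 xib]] := cadlag_bounded xic s0.
have [d2 d20 [M2 M20 Xb]] := cadlag_bounded Xc s0.
(* [D * th] bounds the total of the error terms: the germ and [X] across [s],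
   the increments of [K] near [s], and the convergence of the sums for [X]. *)
pose D := M1 + 2 * M + (`|c| + e) * (2 + 4 * M2) + 1.
have D0 : 0 < D.
  have c0 := normr_ge0 c.
  have : 0 <= (`|c| + e) * (2 + 4 * M2) by apply: mulr_ge0; lra.
  rewrite /D; lra.
pose th := h / D; have th0 : 0 < th by exact: divr_gt0.
have hth : h = th * D by rewrite /th divfK// gt_eqF.
have [d3 /= d30 Zr] := cvg_dist_near (cadlag_cvg true Zc s0) th0.
have [d4 /= d40 Xr] := cvg_dist_near (cadlag_cvg true Xc s0) th0.
have [d5 /= d50 ar] := cvg_dist_near (cadlag_cvg true ac s0) th0.
pose d := Num.min h (Num.min (t - s)
  (Num.min d1 (Num.min d2 (Num.min d3 (Num.min d4 d5))))).
have : 0 < d by rewrite !lt_min h0 d10 d20 d30 d40 d50 subr_gt0 st.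
move=> /(mesh_lt hmesh) Hm.
have Ht : \forall n \near \oo, `|qv_sum (Pi n) X t - bracket Pi X t| < th.
  exact: cvg_dist_near (Xcv t (le_trans s0 (ltW st))) th0.
have Hs : \forall n \near \oo, `|qv_sum (Pi n) X s - bracket Pi X s| < th.
  exact: cvg_dist_near (Xcv s s0) th0.
near=> n.
have Hmn : forall i, Pi n i.+1 - Pi n i < d by near: n.
have : `|qv_sum (Pi n) X t - bracket Pi X t| < th by near: n.
have : `|qv_sum (Pi n) X s - bracket Pi X s| < th by near: n.
have dts : d <= t - s by rewrite /d !ge_min lexx !orbT.
have [k [l [/andP[ks sk] kl /andP[lt tl] H]]] :=
  germ_sum_split (hPi n) s0 Hmn dts.
have := Hmn k; have := Hmn l.
rewrite /d !lt_min => /andP[hl _] /andP[_ /andP[_]].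
move=> /andP[k1 /andP[k2 /andP[k3 /andP[k4 k5]]]].
rewrite !ltr_norml => /andP[Qs1 Qs2] /andP[Qt1 Qt2].
have kl' := partition_le (hPi n) kl.
exists (Pi n l); split => //.
  - by move: hl tl; clear; lra.
  - exact: le_trans (ltW sk) kl'.
rewrite !ito_sumE// H; [|by rewrite /ito_germ subrr mulr0..].
have HX := H (sqr_germ X).
rewrite -/(qv_sum _ _ _) -!qv_sumE in HX.
have := germ_approx_inner (Pi n) k.+1 l app.
have pS i : Pi n i <= Pi n i.+1 by have [_ /(_ i) /ltW] := hPi n.
move=> /(_ pS kl).
have pI i : (k.+1 <= i <= l)%N -> I (Pi n i).
  move=> /andP[ki il]; apply: sI.
  have := partition_le (hPi n) il; have := partition_le (hPi n) ki.
  by move: sk lt; clear; lra.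
move=> /(_ pI).
set q := \sum_(_ <= _ < _) sqr_germ _ _ _ in HX *.
set SE := \sum_(_ <= _ < _) _.
set u := Pi n k.+1 in sk kl' pS k1 k2 k3 k4 k5 *.
set v := Pi n l.
set w := Pi n k in ks k1 k2 k3 k4 k5 *.
move=> Hin.
have w0 : 0 <= w by exact: partition_ge0.
have usd dd : u - w < dd -> half_nbhd true s dd u.
  move: w0 ks sk; clear => ? ? ? ?; split; [lra|apply/andP; split; lra].
have wsd dd : u - w < dd -> `|w - s| < dd.
  move: ks sk; clear => ? ? ?; rewrite ltr_norml; apply/andP; split; lra.
have usd' dd : u - w < dd -> `|u - s| < dd.
  move: ks sk; clear => ? ? ?; rewrite ltr_norml; apply/andP; split; lra.
have b1 := xib w w0 (wsd _ k1).
have b2 := Xb w w0 (wsd _ k2).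
have b3 := Xb u (partition_ge0 _ (hPi n)) (usd' _ k2).
have b4 : `|X s| <= M2 by apply: Xb; rewrite // subrr normr0.
have z1 := Zr u (usd _ k3); have x1 := Xr u (usd _ k4); have a1 := ar u (usd _ k5).
rewrite /= in z1 x1 a1.
have strE : `|ito_germ xi Z w u - ito_germ xi Z w s| <= M1 * th.
  rewrite /ito_germ -mulrBr normrM ler_pM//.
  by rewrite (_ : _ - _ = Z u - Z s); [exact: ltW|ring].
have strX : `|sqr_germ X w u - sqr_germ X w s| <= th * (4 * M2).
  rewrite /sqr_germ.
  have -> : (X u - X w) ^+ 2 - (X s - X w) ^+ 2 =
    (X u - X s) * (X u + X s - 2 * X w) by ring.
  rewrite normrM ler_pM//; first exact: ltW.
  move: b2 b3 b4; clear; rewrite !ler_norml => /andP[? ?] /andP[? ?] /andP[? ?].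
  by apply/andP; split; lra.
have strK : `|K u - K s| <= M * (2 * th).
  have Is : I s by apply: sI; rewrite lexx.
  have Iu : I u.
    by apply: sI; rewrite ltW//= (le_lt_trans kl').
  apply: le_trans (app.2 s u Is Iu (ltW sk)) _; apply: ler_wpM2l => //.
  have := ler_norm (a u - a s); move: a1 x1; clear; lra.
have aus : a s <= a u by exact/ainc/ltW.
have {}HX := HX _ _.
rewrite /sqr_germ !subrr expr0n/= in HX; have {HX} HX := HX erefl erefl.
rewrite -/(sqr_germ X w u) -/(sqr_germ X w s) in HX.
set B := bracket Pi X t - bracket Pi X s - _.
have qB : `|q - B| <= th * (2 + 4 * M2).
  have -> : q = qv_sum (Pi n) X t - qv_sum (Pi n) X s
      - (sqr_germ X w u - sqr_germ X w s) - (X t - X v) ^+ 2.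
    by rewrite HX; ring.
  move: strX; rewrite /B ler_norml => /andP[p1 p2].
  by apply: norm_le_of_bounds; move: Qt1 Qt2 Qs1 Qs2 p1 p2; clear; lra.
have cqB : `|c * (q - B)| <= `|c| * (th * (2 + 4 * M2)).
  by rewrite normrM ler_wpM2l.
have eqB : e * q <= e * B + e * (th * (2 + 4 * M2)).
  rewrite -mulrDr ler_wpM2l//; move: qB; clear; rewrite ler_norml => /andP[? ?]; lra.
have eau : e * (a v - a u) <= e * (a v - a s) by rewrite ler_wpM2l// lerD2l lerN2.
have -> : ito_germ xi Z w u - ito_germ xi Z w s + SE + ito_germ xi Z v t -
   ito_germ xi Z v t - (K v - K s) - c * B =
   (ito_germ xi Z w u - ito_germ xi Z w s) + (SE - (K v - K u) - c * q)
   + c * (q - B) - (K u - K s) by ring.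
have -> : h = M1 * th + M * (2 * th) + `|c| * (th * (2 + 4 * M2)) +
   e * (th * (2 + 4 * M2)) + th by rewrite hth /D; ring.
apply: (norm_le_sum4 strE Hin cqB strK).
move: th0 eqB eau; clear; lra.
Unshelve. all: by end_near.
Qed.

Lemma left_limit_le {R : realType} {a : R -> R} {t : R} : increasing_path a ->
  0 <= t -> left_limit a t <= a t.
Proof.
move=> [ac ainc]; rewrite le_eqVlt => /predU1P[<-|t0]; first by rewrite /left_limit ltxx.
have ? : ProperFilter (half_nbhds false t) by exact: half_nbhds_proper.
have := cadlag_cvg false ac (ltW t0).
move=> /cvgr_to_le; apply; exists 1 => //= s [s0 /andP[_ st]].
exact/ainc/ltW.
Qed.

Lemma left_limit_ge {R : realType} {a : R -> R} {s t : R} : increasing_path a ->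
  0 <= s -> s < t -> a s <= left_limit a t.
Proof.
move=> [ac ainc] s0 st; have t0 : 0 < t by exact: le_lt_trans st.
have ? : ProperFilter (half_nbhds false t) by exact: half_nbhds_proper.
have := cadlag_cvg false ac (ltW t0).
move=> /cvgr_to_ge; apply; exists (t - s); first by rewrite /= subr_gt0.
move=> u [u0 /andP[su _]]; apply: ainc => //; lra.
Qed.

Lemma half_nbhd_left_near {R : realType} (s : R) {t : R}
    {P : R -> Prop} : s < t ->
  0 <= s -> (forall u, s <= u < t -> P u) -> \forall u \near half_nbhds false t, P u.
Proof.
move=> st s0 H; exists (t - s); first by rewrite /= subr_gt0.
by move=> u [u0 /andP[su ut]]; apply: H; rewrite ut andbT; lra.
Qed.

(** * Existence of the integral *)

Lemma germ_approx_left_limit {R : realType} {X a : R -> R} {E : R -> R -> R}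
    {I : set R} {e : R} {K : R -> R} {c M s t : R} :
  cadlag X -> increasing_path a -> 0 <= M ->
  germ_approx X a E I e K c M -> 0 <= s -> s < t ->
  (forall u, s <= u < t -> I u) ->
  cvg (K v @[v --> half_nbhds false t]).
Proof.
move=> Xc [ac ainc] M0 [_ HK] s0 st sI.
have t0 : 0 < t by exact: le_lt_trans st.
have pf : ProperFilter (half_nbhds false t) by exact: half_nbhds_proper.
apply: cauchy_cvg; apply: cauchy_exP => h /= h0.
pose th := h / (4 * (M + 1)).
have th0 : 0 < th by apply: divr_gt0 => //; lra.
have hth : h = th * (4 * (M + 1)) by rewrite /th divfK// gt_eqF//; lra.
have HX : \forall v \near half_nbhds false t, `|X v - left_limit X t| < th.
  exact: (cvg_dist_near (cadlag_cvg false Xc (ltW t0))).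
have Ha : \forall v \near half_nbhds false t, `|a v - left_limit a t| < th.
  exact: (cvg_dist_near (cadlag_cvg false ac (ltW t0))).
have Hst := half_nbhd_left_near _ st s0 (fun u (H : s <= u < t) => H).
near (half_nbhds false t) => v.
have vI : s <= v < t by near: v.
have v1 : `|X v - left_limit X t| < th by near: v.
have v2 : `|a v - left_limit a t| < th by near: v.
exists (K v).
have : \forall u \near half_nbhds false t, `|K v - K u| < h.
  near=> u.
  have u1 : `|X u - left_limit X t| < th by near: u.
  have u2 : `|a u - left_limit a t| < th by near: u.
  have uI : s <= u < t by near: u.
  have bnd : `|K v - K u| <= M * (`|X u - X v| + `|a u - a v|).
    have [uv|/ltW vu] := leP u v.
      have := HK u v (sI _ uI) (sI _ vI) uv; rewrite distrC [`|X v - X u|]distrC.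
      rewrite distrC => /le_trans; apply; rewrite ler_wpM2l// lerD2l.
      by rewrite distrC ler_norm.
    have := HK v u (sI _ vI) (sI _ uI) vu; rewrite distrC => /le_trans; apply.
    by rewrite ler_wpM2l// lerD2l ler_norm.
  apply: le_lt_trans bnd _.
  have : `|X u - X v| + `|a u - a v| <= 4 * th.
    have := ler_distD (left_limit X t) (X u) (X v).
    have := ler_distD (left_limit a t) (a u) (a v).
    rewrite [`|left_limit X t - _|]distrC [`|left_limit a t - _|]distrC.
    move: u1 u2 v1 v2; clear; lra.
  move=> /(ler_wpM2l M0) /le_lt_trans; apply.
  rewrite hth; move: th0; clear; lra.
by [].
Unshelve. all: by end_near.
Qed.

Lemma ito_sum_increment_cvg {R : realType} {Pi : nat -> nat -> R}
    {X a xi Z : R -> R} {I : set R} {e : R} {K : R -> R} {c M s t : R} :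
  (forall n, is_partition (Pi n)) -> mesh (Pi n) @[n --> \oo] --> 0%E ->
  QV Pi X -> increasing_path a -> cadlag xi -> cadlag Z -> 0 <= e -> 0 <= M ->
  germ_approx X a (ito_germ xi Z) I e K c M ->
  0 <= s -> s < t -> (forall u, s <= u < t -> I u) ->
  exists2 k, K v @[v --> half_nbhds false t] --> k &
  forall h, 0 < h -> \forall n \near \oo,
    `|ito_sum (Pi n) xi Z t - ito_sum (Pi n) xi Z s
      - left_limit xi t * jump Z t - (k - K s)
      - c * (bracket Pi X t - bracket Pi X s - jump X t ^+ 2)|
    <= e * (left_limit a t - a s
            + (bracket Pi X t - bracket Pi X s - jump X t ^+ 2)) + h.
Proof.
move=> hPi hmesh hX ha xic Zc e0 M0 app s0 st sI.
have t0 : 0 < t by exact: le_lt_trans st.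
have [Xc _ _ _ _] := hX.
have /cvg_ex[k Kk] := germ_approx_left_limit Xc ha M0 app s0 st sI.
exists k => // h h0; have h20 : 0 < h / 4 by lra.
pose B := bracket Pi X t - bracket Pi X s.
pose Phi v := ito_germ xi Z v t + (K v - K s) + c * (B - (X t - X v) ^+ 2).
pose Psi v := e * (a v - a s + (B - (X t - X v) ^+ 2)).
have cX := cadlag_cvg false Xc (ltW t0).
have cX2 : (X t - X v) ^+ 2 @[v --> half_nbhds false t] --> jump X t ^+ 2.
  have ct : (X t - X v) @[v --> half_nbhds false t] --> jump X t.
    by apply: cvgB => //; exact: cvg_cst.
  exact: (cvgM ct ct).
have cPhi : Phi v @[v --> half_nbhds false t] -->
    left_limit xi t * jump Z t + (k - K s) + c * (B - jump X t ^+ 2).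
  apply: cvgD; last by apply: cvgM; [exact: cvg_cst|apply: cvgB => //; exact: cvg_cst].
  apply: cvgD; last by apply: cvgB => //; exact: cvg_cst.
  apply: cvgM; first exact: (cadlag_cvg false xic (ltW t0)).
  apply: cvgB; first exact: cvg_cst.
  exact: (cadlag_cvg false Zc (ltW t0)).
have cPsi : Psi v @[v --> half_nbhds false t] -->
    e * (left_limit a t - a s + (B - jump X t ^+ 2)).
  apply: cvgM; first exact: cvg_cst.
  apply: cvgD; last by apply: cvgB => //; exact: cvg_cst.
  by apply: cvgB; [exact: (cadlag_cvg false ha.1 (ltW t0))|exact: cvg_cst].
have [d1 /= d10 H1] := cvg_dist_near cPhi h20.
have [d2 /= d20 H2] := cvg_dist_near cPsi h20.
pose d := Num.min (h / 4) (Num.min d1 d2).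
have d0 : 0 < d by rewrite !lt_min h20 d10 d20.
have := ito_sum_increment hPi hmesh hX ha xic Zc e0 M0 app s0 st sI d0.
apply: filterS => n [v [tv sv vt]].
have dh : d <= h / 4 by rewrite /d ge_min lexx.
have vd dd : d <= dd -> half_nbhd false t dd v.
  move: tv sv vt s0; clear => *; split; first by lra.
  by apply/andP; split; lra.
have p1 : `|Phi v - (left_limit xi t * jump Z t + (k - K s)
    + c * (B - jump X t ^+ 2))| < h / 4.
  by apply: H1; apply: vd; rewrite /d !ge_min lexx !orbT.
have p2 : `|Psi v - e * (left_limit a t - a s + (B - jump X t ^+ 2))| < h / 4.
  by apply: H2; apply: vd; rewrite /d !ge_min lexx !orbT.
move: p1 p2 dh; rewrite /Phi /Psi -/B !ler_norml !ltr_norml; clear.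
move=> /andP[? ?] /andP[? ?] ? /andP[? ?]; apply/andP; split; lra.
Qed.

(** [u] oscillates asymptotically by at most [2 e]; the centre [G] may depend on
    [h], which avoids naming a limit and makes the notion additive. *)
Definition almost_cauchy {R : realType} (u : nat -> R) (e : R) : Prop :=
  forall h, 0 < h -> exists G : R, \forall n \near \oo, `|u n - G| <= e + h.

Lemma almost_cauchyD {R : realType} {u v : nat -> R} {e f : R} :
  almost_cauchy u e -> almost_cauchy v f -> almost_cauchy (u \+ v) (e + f).
Proof.
move=> Hu Hv h h0; have h20 : 0 < h / 2 by lra.
have [G Gu] := Hu _ h20; have [H Gv] := Hv _ h20; exists (G + H).
move: Gu Gv; apply: filterS2 => n; rewrite !ler_norml /=; clear.
by move=> /andP[? ?] /andP[? ?]; apply/andP; split; lra.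
Qed.

Lemma bracket_increasing {R : realType} {Pi : nat -> nat -> R} {X} : QV Pi X ->
  increasing_path (bracket Pi X).
Proof. by move=> [_ _ ? ? _]. Qed.

(** The oscillation of the sums up to time [t] is of the order of [e] times the
    increment of [a + [X,X]] between [0] and [t]: the set of such [t] contains
    [0], is closed under limits from the left by approximation on left
    neighbourhoods, and can be extended to the right of any of its points.  So
    it reaches [T], and [e] is arbitrary. *)
Lemma ito_integral_exists_local {R : realType} (Pi : nat -> nat -> R)
    (X a : R -> R) {xi Z : R -> R} {T : R} :
  (forall n, is_partition (Pi n)) -> mesh (Pi n) @[n --> \oo] --> 0%E ->
  QV Pi X -> increasing_path a -> cadlag xi -> cadlag Z -> 0 <= T ->
  (forall t, 0 <= t <= T -> locally_approx X a (ito_germ xi Z) t) ->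
  ito_integral_exists Pi xi Z T.
Proof.
move=> hPi hmesh hX ha xic Zc T0 loc.
have hbr := bracket_increasing hX.
pose S t n := ito_sum (Pi n) xi Z t.
pose mu t := a t + bracket Pi X t.
pose good e t := almost_cauchy (S t) (e * (mu t - mu 0)).
have step e s t b tau d : 0 < e -> 0 <= s -> s < t ->
    (exists K c M, 0 <= M /\
      germ_approx X a (ito_germ xi Z) (half_nbhd b tau d) e K c M) ->
    (forall u, s <= u < t -> half_nbhd b tau d u) -> good e s -> good e t.
  move=> e0 s0 st [K [c [M [M0 app]]]] sI gs.
  have [k _ H] := ito_sum_increment_cvg
     hPi hmesh hX ha xic Zc (ltW e0) M0 app s0 st sI.
  have : almost_cauchy (fun n => S t n - S s n) (e * (mu t - mu s)).
    move=> h h0; exists (left_limit xi t * jump Z t + (k - K s) +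
      c * (bracket Pi X t - bracket Pi X s - jump X t ^+ 2)).
    move: (H h h0); apply: filterS => n; rewrite -/(S _ _) -/(S _ _).
    rewrite !opprD !addrA => /le_trans; apply.
    rewrite lerD2r ler_wpM2l ?(ltW e0)//.
    have := left_limit_le ha (le_trans s0 (ltW st)).
    by have := sqr_ge0 (jump X t); rewrite /mu; clear; lra.
  move/(almost_cauchyD gs).
  have -> : S s \+ (fun n => S t n - S s n) = S t by apply/funext => n /=; ring.
  by rewrite -mulrDr addrC addrA subrK.
have good0 e : good e 0.
  move=> h h0; exists 0; near=> n.
  rewrite subrr mulr0 add0r subr0 /S ito_sumE// germ_sum0//.
    by rewrite normr0 ltW.
  by rewrite /ito_germ subrr mulr0.
have goodT e : 0 < e -> good e T.
  move=> e0; pose A := [set t | 0 <= t <= T /\ good e t].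
  have A0 : A 0 by split => //; rewrite lexx.
  have supA : has_sup A.
    by split; [exists 0|exists T => t [/andP[]]].
  (* The supremum [m] is itself a good time, by the approximation on its left;
     by the one on its right, it cannot be smaller than [T]. *)
  pose m := sup A.
  have m0 : 0 <= m by apply: ub_le_sup => //; exact: supA.2.
  have mT : m <= T by apply: ge_sup; [exists 0|move=> t [/andP[]]].
  have gm : good e m.
    have [d d0 app] := loc m (introT andP (conj m0 mT)) false e e0.
    have [t At mt] := sup_adherent d0 supA.
    have [/andP[t0 tT] gt] := At.
    have : t <= m by apply: ub_le_sup => //; exact: supA.2.
    rewrite le_eqVlt => /predU1P[<-//|tm].
    apply: (step e t m false m d) => // u /andP[tu um]; split; first exact: le_trans tu.
    by rewrite um andbT (lt_le_trans mt).
  have [->//|] := eqVneq T m; rewrite neq_lt ltNge mT /= => mltT.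
  have [d d0 app] := loc m (introT andP (conj m0 mT)) true e e0.
  pose t := Num.min T (m + d / 2).
  have mt : m < t by rewrite lt_min mltT; lra.
  have tmd : t <= m + d / 2 by rewrite /t ge_min lexx orbT.
  have gt : good e t.
    apply: (step e m t true m d) => // u /andP[mu' ut]; split; first exact: le_trans mu'.
    by rewrite mu' /=; move: ut tmd d0; clear; lra.
  have tm : t <= m.
    apply: ub_le_sup; first exact: supA.2.
    split=> //; rewrite (le_trans m0 (ltW mt))/=.
    by rewrite /t ge_min lexx.
  by have := lt_le_trans mt tm; rewrite ltxx.
apply: cauchy_cvg; apply: cauchy_exP => h /= h0.
have mu0 : 0 <= mu T - mu 0.
  by rewrite subr_ge0 lerD//; [exact: ha.2|exact: hbr.2].
pose e := h / 4 / (mu T - mu 0 + 1).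
have e0 : 0 < e by apply: divr_gt0; lra.
have h40 : 0 < h / 4 by lra.
have [G HG] := goodT _ e0 _ h40.
exists G; near=> n; rewrite /ball/= distrC.
have : `|S T n - G| <= e * (mu T - mu 0) + h / 4 by near: n.
move/le_lt_trans; apply.
have : e * (mu T - mu 0 + 1) = h / 4 by rewrite /e divfK// gt_eqF//; lra.
by move: e0 h0; clear; lra.
Unshelve. all: by end_near.
Qed.

(** * Regularity of the integral *)

Lemma ito_integral_increment {R : realType} {Pi : nat -> nat -> R}
    {X a xi Z : R -> R} {I : set R} {e : R} {K : R -> R} {c M s t : R} :
  (forall n, is_partition (Pi n)) -> mesh (Pi n) @[n --> \oo] --> 0%E ->
  QV Pi X -> increasing_path a -> cadlag xi -> cadlag Z -> 0 <= e -> 0 <= M ->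
  (forall t, 0 <= t -> ito_integral_exists Pi xi Z t) ->
  germ_approx X a (ito_germ xi Z) I e K c M ->
  0 <= s -> s < t -> (forall u, s <= u < t -> I u) ->
  exists2 k, K v @[v --> half_nbhds false t] --> k &
    `|ito_integral Pi xi Z t - ito_integral Pi xi Z s
      - left_limit xi t * jump Z t - (k - K s)
      - c * (bracket Pi X t - bracket Pi X s - jump X t ^+ 2)|
    <= e * (left_limit a t - a s
            + (bracket Pi X t - bracket Pi X s - jump X t ^+ 2)).
Proof.
move=> hPi hmesh hX ha xic Zc e0 M0 ex app s0 st sI.
have [k Kk H] := ito_sum_increment_cvg
     hPi hmesh hX ha xic Zc e0 M0 app s0 st sI.
exists k => //; apply/ler_addgt0Pr => h h0.
have := H h h0; apply: cvgr_to_le.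
apply: cvg_norm; do 3 (apply: cvgB; last exact: cvg_cst).
by apply: cvgB; apply: ex => //; exact: (le_trans s0 (ltW st)).
Qed.

(** Unlike in the previous lemma the right end point belongs to [I]; the jump
    term is then itself approximated, by letting the first argument of the germ
    tend to [t]. *)
Lemma ito_integral_local {R : realType} {Pi : nat -> nat -> R}
    {X a xi Z : R -> R} {I : set R} {e : R} {K : R -> R} {c M s t : R} :
  (forall n, is_partition (Pi n)) -> mesh (Pi n) @[n --> \oo] --> 0%E ->
  QV Pi X -> increasing_path a -> cadlag xi -> cadlag Z -> 0 <= e -> 0 <= M ->
  (forall t, 0 <= t -> ito_integral_exists Pi xi Z t) ->
  germ_approx X a (ito_germ xi Z) I e K c M ->
  0 <= s -> s <= t -> (forall u, s <= u <= t -> I u) ->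
  `|ito_integral Pi xi Z t - ito_integral Pi xi Z s - (K t - K s)|
  <= (`|c| + e) * (a t - a s + (bracket Pi X t - bracket Pi X s)).
Proof.
move=> hPi hmesh hX ha xic Zc e0 M0 ex app s0.
rewrite le_eqVlt => /predU1P[<- _|st sI].
  by rewrite !subrr addr0 mulr0 normr0.
have t0 : 0 < t by exact: le_lt_trans st.
have sI' u : s <= u < t -> I u by move=> /andP[su ut]; apply: sI; rewrite su ltW.
have [k Kk Hk] := ito_integral_increment
     hPi hmesh hX ha xic Zc e0 M0 ex app s0 st sI'.
have pf : ProperFilter (half_nbhds false t) by exact: half_nbhds_proper.
have [Xc _ _ _ _] := hX.
have cX2 : (X t - X v) ^+ 2 @[v --> half_nbhds false t] --> jump X t ^+ 2.
  have ct : (X t - X v) @[v --> half_nbhds false t] --> jump X t.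
    by apply: cvgB; [exact: cvg_cst|exact: (cadlag_cvg false Xc (ltW t0))].
  exact: (cvgM ct ct).
have HJ : `|left_limit xi t * jump Z t - (K t - k) - c * jump X t ^+ 2| <=
    e * (a t - left_limit a t + jump X t ^+ 2).
  rewrite -subr_le0.
  have : (`|ito_germ xi Z v t - (K t - K v) - c * (X t - X v) ^+ 2|
       - e * (a t - a v + (X t - X v) ^+ 2)) @[v --> half_nbhds false t] -->
    `|left_limit xi t * jump Z t - (K t - k) - c * jump X t ^+ 2| -
    e * (a t - left_limit a t + jump X t ^+ 2).
    apply: cvgB; last first.
      apply: cvgM; first exact: cvg_cst.
      apply: cvgD => //; apply: cvgB; first exact: cvg_cst.
      exact: (cadlag_cvg false ha.1 (ltW t0)).
    apply: cvg_norm; apply: cvgB; last by apply: cvgM => //; exact: cvg_cst.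
    apply: cvgB; last by apply: cvgB => //; exact: cvg_cst.
    apply: cvgM; first exact: (cadlag_cvg false xic (ltW t0)).
    apply: cvgB; first exact: cvg_cst.
    exact: (cadlag_cvg false Zc (ltW t0)).
  move=> /cvgr_to_le; apply.
  apply: (half_nbhd_left_near s) => // v /andP[sv vt].
  rewrite subr_le0; apply: app.1; [|by apply: sI; rewrite lexx ltW|exact: ltW].
  by apply: sI; rewrite sv ltW.
set br := bracket Pi X in Hk *.
have binc : 0 <= br t - br s.
  by rewrite subr_ge0; apply: (bracket_increasing hX).2 => //; exact: ltW.
have ainc : 0 <= a t - a s by rewrite subr_ge0; apply: ha.2 => //; exact: ltW.
have cb : `|c * (br t - br s)| <= `|c| * (a t - a s + (br t - br s)).
  by rewrite normrM (ger0_norm binc) ler_wpM2l// lerDr.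
move: Hk HJ cb; clear.
rewrite !ler_norml => /andP[? ?] /andP[? ?] /andP[? ?].
by apply/andP; split; lra.
Qed.

Definition ito_regular {R : realType} (Pi : nat -> nat -> R) (xi Z : R -> R) :=
  [/\ forall t, 0 <= t -> ito_integral_exists Pi xi Z t,
      cadlag (ito_integral Pi xi Z) &
      forall t, 0 <= t ->
        left_limit (ito_integral Pi xi Z) t =
        ito_integral Pi xi Z t - left_limit xi t * jump Z t].

(** Right continuity at [t] comes from the approximation on a right neighbourhood
    of [t].  On a left neighbourhood, all contributions except the jump term
    vanish as [s] tends to [t], because [[X,X]_t - (jump X t)^2] is the left
    limit of [[X,X]]: this is where the jump condition in the definition of the
    quadratic variation is used. *)
Lemma ito_regular_local {R : realType} (Pi : nat -> nat -> R) (X : R -> R)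
    {xi Z : R -> R} :
  (forall n, is_partition (Pi n)) -> mesh (Pi n) @[n --> \oo] --> 0%E ->
  QV Pi X -> cadlag xi -> cadlag Z ->
  (forall T, 0 < T -> exists2 a, increasing_path a &
    forall t, 0 <= t <= T -> locally_approx X a (ito_germ xi Z) t) ->
  ito_regular Pi xi Z.
Proof.
move=> hPi hmesh hX xic Zc loc.
have [Xc _ brc brinc brjump] := hX.
have ex t : 0 <= t -> ito_integral_exists Pi xi Z t.
  move=> t0; have t10 : 0 < t + 1 by lra.
  have [a ha H] := loc _ t10.
  apply: (ito_integral_exists_local Pi X a) => // u /andP[u0 ut].
  by apply: H; rewrite u0 /=; lra.
have right t : 0 <= t ->
    ito_integral Pi xi Z s @[s --> half_nbhds true t] --> ito_integral Pi xi Z t.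
  move=> t0; have t10 : 0 < t + 1 by lra.
  have [a ha H] := loc _ t10.
  have tt1 : 0 <= t <= t + 1 by apply/andP; split; lra.
  have [d d0 [K [c [M [M0 app]]]]] := H t tt1 true 1 ltr01.
  pose W s := M * (`|X s - X t| + (a s - a t)) +
    (`|c| + 1) * (a s - a t + (bracket Pi X s - bracket Pi X t)).
  have W0 : W s @[s --> half_nbhds true t] --> 0.
    have -> : 0 = M * (`|X t - X t| + (a t - a t)) +
    (`|c| + 1) * (a t - a t + (bracket Pi X t - bracket Pi X t)).
      by rewrite !subrr normr0 !addr0 !mulr0 addr0.
    have ca := cadlag_cvg true ha.1 t0.
    have cX := cadlag_cvg true Xc t0.
    have cb := cadlag_cvg true brc t0.
    apply: cvgD; apply: cvgM; try exact: cvg_cst.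
      apply: cvgD; last by apply: cvgB => //; exact: cvg_cst.
      by apply: cvg_norm; apply: cvgB => //; exact: cvg_cst.
    by apply: cvgD; apply: cvgB => //; exact: cvg_cst.
  apply/cvgrPdist_le => h h0.
  have [d1 /= d10 H1] := cvg_dist_near W0 h0.
  exists (Num.min d d1); first by rewrite /= lt_min d0.
  move=> s ts.
  have /= := H1 s (half_nbhd_le (_ : Num.min d d1 <= d1) s ts).
  rewrite ge_min lexx orbT subr0 => /(_ isT); rewrite ltr_norml => /andP[_ Wh].
  have [s0 /andP[ts' std]] := ts.
  have sd : s < t + d by rewrite (lt_le_trans std)// lerD2l ge_min lexx.
  have It u : t <= u <= s -> half_nbhd true t d u.
    move=> /andP[tu us]; split; first exact: le_trans tu.
    by rewrite tu /= (le_lt_trans us).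
  have := ito_integral_local hPi hmesh hX ha xic Zc
    ler01 M0 ex app t0 ts' It.
  have := app.2 t s (It t _) (It s _) ts'; rewrite !lexx ts' => /(_ isT isT).
  rewrite distrC; move: Wh; rewrite /W; clear; rewrite !ler_norml.
  by move=> ? /andP[? ?] /andP[? ?]; apply/andP; split; lra.
have left t : 0 < t ->
    ito_integral Pi xi Z s @[s --> half_nbhds false t] -->
    ito_integral Pi xi Z t - left_limit xi t * jump Z t.
  move=> t0; have t10 : 0 < t + 1 by lra.
  have [a ha H] := loc _ t10.
  have tt1 : 0 <= t <= t + 1 by apply/andP; split; lra.
  have [d d0 [K [c [M [M0 app]]]]] := H t tt1 false 1 ltr01.
  have pf : ProperFilter (half_nbhds false t) by exact: half_nbhds_proper.
  have /cvg_ex[k Kk] : cvg (K v @[v --> half_nbhds false t]).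
    have s0 : 0 <= Num.max 0 (t - d / 2) by rewrite le_max lexx.
    have st : Num.max 0 (t - d / 2) < t by rewrite gt_max t0 /=; lra.
    apply: (germ_approx_left_limit Xc ha M0 app s0 st).
    move=> u; rewrite ge_max => /andP[/andP[u0 du] ut]; split => //.
    by rewrite ut andbT; move: du d0; clear; lra.
  pose W s := `|k - K s| + (`|c| + 1) *
    (left_limit a t - a s + (left_limit (bracket Pi X) t - bracket Pi X s)).
  have W0 : W s @[s --> half_nbhds false t] --> 0.
    have -> : 0 = `|k - k| + (`|c| + 1) *
      (left_limit a t - left_limit a t +
        (left_limit (bracket Pi X) t - left_limit (bracket Pi X) t)).
      by rewrite !subrr normr0 addr0 mulr0 addr0.
    have ca := cadlag_cvg false ha.1 (ltW t0).
    have cb := cadlag_cvg false brc (ltW t0).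
    apply: cvgD; first by apply: cvg_norm; apply: cvgB => //; exact: cvg_cst.
    apply: cvgM; first exact: cvg_cst.
    by apply: cvgD; apply: cvgB => //; exact: cvg_cst.
  apply/cvgrPdist_le => h h0.
  have [d1 /= d10 H1] := cvg_dist_near W0 h0.
  exists (Num.min d d1); first by rewrite /= lt_min d0.
  move=> s ts.
  have /= := H1 s (half_nbhd_le (_ : Num.min d d1 <= d1) s ts).
  rewrite ge_min lexx orbT subr0 => /(_ isT); rewrite ltr_norml => /andP[_ Wh].
  have [s0 /andP[ts' st]] := ts.
  have sd : t - d < s by rewrite (le_lt_trans _ ts')// lerD2l lerN2 ge_min lexx.
  have It u : s <= u < t -> half_nbhd false t d u.
    move=> /andP[su ut]; split; first exact: le_trans su.
    by rewrite ut andbT (lt_le_trans sd).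
  have [k' Kk' Hk'] := ito_integral_increment
    hPi hmesh hX ha xic Zc ler01 M0 ex app s0 st It.
  have {Kk'} kk : k' = k by exact: (cvg_unique _ Kk' Kk).
  move: Hk'; rewrite kk -(brjump t (ltW t0)).
  rewrite [X in c * (_ - X)]/jump [X in _ <= 1 * (_ + (_ - X))]/jump.
  have bl := left_limit_ge (bracket_increasing hX) s0 st.
  have al := left_limit_ge ha s0 st.
  rewrite /W in Wh; move: bl Wh; set br := bracket Pi X => bl Wh.
  have -> : br t - br s - (br t - left_limit br t) = left_limit br t - br s by ring.
  move=> Hk.
  have cb : `|c * (left_limit br t - br s)| <=
      `|c| * (left_limit a t - a s + (left_limit br t - br s)).
    by rewrite normrM [`|_ - br s|]ger0_norm ?subr_ge0// ler_wpM2l// lerDr subr_ge0.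
  have kn : - `|k - K s| <= k - K s <= `|k - K s| by rewrite -ler_norml.
  move: Hk cb kn Wh; clear; rewrite !ler_norml.
  move=> /andP[? ?] /andP[? ?] /andP[? ?] ?; apply/andP; split; lra.
split; first exact: ex.
  apply: cadlag_of_cvg; first exact: right.
  by move=> t t0; eexists; exact: left.
move=> t; rewrite le_eqVlt => /predU1P[<-|t0].
  by rewrite /jump /left_limit ltxx subrr mulr0 subr0.
exact/left_limit_cvg/left.
Qed.

(** * Bilinearity, and quadratic variation by parts *)

Lemma ito_sumDl {R : realType} {p : nat -> R} (xi xi' Z : R -> R) (t : R) :
  is_partition p ->
  ito_sum p (xi \+ xi') Z t = ito_sum p xi Z t + ito_sum p xi' Z t.
Proof.
move=> hp; rewrite !ito_sumE//; have [N /ltW tN] := partition_unbounded t hp.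
rewrite !(germ_sumE N)//; [|by rewrite /ito_germ subrr mulr0..].
by rewrite -big_split; apply: eq_bigr => i _; rewrite /ito_germ /= mulrDl.
Qed.

Lemma ito_sumDr {R : realType} {p : nat -> R} (xi Z Z' : R -> R) (t : R) :
  is_partition p ->
  ito_sum p xi (Z \+ Z') t = ito_sum p xi Z t + ito_sum p xi Z' t.
Proof.
move=> hp; rewrite !ito_sumE//; have [N /ltW tN] := partition_unbounded t hp.
rewrite !(germ_sumE N)//; [|by rewrite /ito_germ subrr mulr0..].
by rewrite -big_split; apply: eq_bigr => i _; rewrite /ito_germ /=; ring.
Qed.

Lemma ito_regular_add {R : realType} {Pi : nat -> nat -> R}
    {xi Z xi1 Z1 xi2 Z2 : R -> R} :
  (forall n t, ito_sum (Pi n) xi Z t =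
    ito_sum (Pi n) xi1 Z1 t + ito_sum (Pi n) xi2 Z2 t) ->
  (forall t, 0 <= t -> left_limit xi t * jump Z t =
    left_limit xi1 t * jump Z1 t + left_limit xi2 t * jump Z2 t) ->
  ito_regular Pi xi1 Z1 -> ito_regular Pi xi2 Z2 ->
  ito_regular Pi xi Z /\
  forall t, 0 <= t -> ito_integral Pi xi Z t =
    ito_integral Pi xi1 Z1 t + ito_integral Pi xi2 Z2 t.
Proof.
move=> hS hJ [ex1 c1 j1] [ex2 c2 j2].
have cv t : 0 <= t -> ito_sum (Pi n) xi Z t @[n --> \oo] -->
    ito_integral Pi xi1 Z1 t + ito_integral Pi xi2 Z2 t.
  move=> t0; under eq_fun do rewrite hS.
  by apply: cvgD; [exact: ex1|exact: ex2].
have E t : 0 <= t -> (ito_integral Pi xi1 Z1 \+ ito_integral Pi xi2 Z2) t =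
    ito_integral Pi xi Z t.
  by move=> t0; apply/esym/cvg_lim => //; exact: cv.
have [cc ll] := cadlag_add c1 c2.
split; last by move=> t t0; rewrite -E.
split; first by move=> t t0; apply/cvg_ex; eexists; exact: cv.
  exact: cadlag_ext E cc.
move=> t t0; rewrite -(left_limit_ext E cc t0) ll// hJ// -E//= j1// j2//.
ring.
Qed.

Lemma ito_regularDl {R : realType} {Pi : nat -> nat -> R} {xi xi' Z : R -> R} :
  (forall n, is_partition (Pi n)) -> cadlag xi -> cadlag xi' ->
  ito_regular Pi xi Z -> ito_regular Pi xi' Z ->
  ito_regular Pi (xi \+ xi') Z /\
  forall t, 0 <= t -> ito_integral Pi (xi \+ xi') Z t =
    ito_integral Pi xi Z t + ito_integral Pi xi' Z t.
Proof.
move=> hPi c c'; apply: ito_regular_add => [n t|t t0]; first exact: ito_sumDl.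
by rewrite (cadlag_add c c').2// mulrDl.
Qed.

Lemma ito_regularDr {R : realType} {Pi : nat -> nat -> R} {xi Z Z' : R -> R} :
  (forall n, is_partition (Pi n)) -> cadlag Z -> cadlag Z' ->
  ito_regular Pi xi Z -> ito_regular Pi xi Z' ->
  ito_regular Pi xi (Z \+ Z') /\
  forall t, 0 <= t -> ito_integral Pi xi (Z \+ Z') t =
    ito_integral Pi xi Z t + ito_integral Pi xi Z' t.
Proof.
move=> hPi c c'; apply: ito_regular_add => [n t|t t0]; first exact: ito_sumDr.
by rewrite /jump (cadlag_add c c').2//=; ring.
Qed.

Lemma qv_sum_by_parts {R : realType} {p : nat -> R} (W : R -> R) {t : R} :
  is_partition p -> 0 <= t ->
  qv_sum p W t = W t ^+ 2 - W 0 ^+ 2 - 2 * ito_sum p W W t.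
Proof.
move=> hp t0; rewrite ito_sumE// qv_sumE.
have [N /ltW tN] := partition_unbounded t hp.
rewrite !(germ_sumE N)//; [|by rewrite /ito_germ subrr mulr0|
  by rewrite /sqr_germ subrr expr0n].
have -> : W t ^+ 2 - W 0 ^+ 2 =
    \sum_(0 <= i < N) (W (Num.min (p i.+1) t) ^+ 2 - W (Num.min (p i) t) ^+ 2).
  rewrite (telescope_sumr (fun i => W (Num.min (p i) t) ^+ 2))//.
  by rewrite (min_idPr tN); have [-> _ _] := hp; rewrite (min_idPl t0).
rewrite mulr_sumr -sumrB; apply: eq_bigr => i _.
by rewrite /sqr_germ /ito_germ; ring.
Qed.

(** The sums are not monotone in [t], since the term straddling [s] changes, but
    that term changes by [(W u - W s) * (W u + W s - 2 * W w)], which is small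
    by right continuity at [s]. *)
Lemma qv_sum_almost_increasing {R : realType} {Pi : nat -> nat -> R}
    {W : R -> R} {s t h : R} :
  (forall n, is_partition (Pi n)) -> mesh (Pi n) @[n --> \oo] --> 0%E ->
  cadlag W -> 0 <= s -> s < t -> 0 < h ->
  \forall n \near \oo, qv_sum (Pi n) W s - h <= qv_sum (Pi n) W t.
Proof.
move=> hPi hmesh Wc s0 st h0.
have [d1 d10 [M M0 Wb]] := cadlag_bounded Wc s0.
pose th := h / (4 * M); have th0 : 0 < th by apply: divr_gt0 => //; lra.
have hth : th * (4 * M) = h by rewrite /th divfK// gt_eqF//; lra.
have [d2 /= d20 Wr] := cvg_dist_near (cadlag_cvg true Wc s0) th0.
pose d := Num.min (t - s) (Num.min d1 d2).
have : 0 < d by rewrite !lt_min d10 d20 subr_gt0 st.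
move=> /(mesh_lt hmesh); apply: filterS => n Hn.
have dts : d <= t - s by rewrite /d !ge_min lexx.
have [k [l [/andP[ks sk] kl /andP[lt tl] H]]] :=
  germ_sum_split (hPi n) s0 Hn dts.
have := H (sqr_germ W); rewrite /sqr_germ !subrr expr0n/= => /(_ erefl erefl).
rewrite -!qv_sumE.
have := Hn k; rewrite /d !lt_min => /andP[_ /andP[k1 k2]].
set u := Pi n k.+1 in sk k1 k2 *; set w := Pi n k in ks k1 k2 *.
set S := \sum_(_ <= _ < _) _.
move=> E.
have S0 : 0 <= S by apply: sumr_ge0 => i _; exact: sqr_ge0.
have L0 : 0 <= (W t - W (Pi n l)) ^+ 2 by exact: sqr_ge0.
have b2 : `|W w| <= M.
  apply: Wb; first exact: partition_ge0.
  by move: ks sk k1; clear => ? ? ?; rewrite ltr_norml; apply/andP; split; lra.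
have b3 : `|W u| <= M.
  apply: Wb; first exact: partition_ge0.
  by move: ks sk k1; clear => ? ? ?; rewrite ltr_norml; apply/andP; split; lra.
have b4 : `|W s| <= M by apply: Wb; rewrite // subrr normr0.
have w1 : `|W u - W s| < th.
  apply: Wr; split; first exact: partition_ge0.
  by move: ks sk k2; clear => ? ? ?; apply/andP; split; lra.
have str : `|(W u - W w) ^+ 2 - (W s - W w) ^+ 2| <= h.
  have -> : (W u - W w) ^+ 2 - (W s - W w) ^+ 2 =
    (W u - W s) * (W u + W s - 2 * W w) by ring.
  rewrite normrM -hth ler_pM//; first exact: ltW.
  move: b2 b3 b4; clear; rewrite !ler_norml => /andP[? ?] /andP[? ?] /andP[? ?].
  by apply/andP; split; lra.
move: E S0 L0 str; rewrite ler_norml; clear => ? ? ? /andP[? ?]; lra.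
Qed.

(** Summation by parts expresses the quadratic variation by the integral.  Its
    jumps are [W^2 - W_-^2 - 2 W_- (W - W_-)], a perfect square. *)
Lemma QV_of_ito_regular {R : realType} {Pi : nat -> nat -> R} {W : R -> R} :
  (forall n, is_partition (Pi n)) -> mesh (Pi n) @[n --> \oo] --> 0%E ->
  cadlag W -> ito_regular Pi W W ->
  QV Pi W /\ forall t, 0 <= t ->
    bracket Pi W t = W t ^+ 2 - W 0 ^+ 2 - 2 * ito_integral Pi W W t.
Proof.
move=> hPi hmesh Wc [ex Ic Ij].
have cv t : 0 <= t -> qv_sum (Pi n) W t @[n --> \oo] -->
    W t ^+ 2 - W 0 ^+ 2 - 2 * ito_integral Pi W W t.
  move=> t0; under eq_fun do rewrite qv_sum_by_parts//.
  by apply: cvgB; [exact: cvg_cst|apply: cvgM; [exact: cvg_cst|exact: ex]].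
pose br := (W \* W) \+ ((fun=> - W 0 ^+ 2) \+ ((fun=> - 2) \* ito_integral Pi W W)).
have brE t : 0 <= t -> br t = bracket Pi W t.
  move=> t0; rewrite /bracket; have /cvg_lim -> // := cv _ t0.
  by rewrite /br /=; ring.
have [Wc2 Wl2] := cadlag_mul Wc Wc.
have [cc1 cl1] := cadlag_cst (- W 0 ^+ 2); have [cc2 cl2] := cadlag_cst (- 2 : R).
have [ccI clI] := cadlag_mul cc2 Ic.
have [cc3 cl3] := cadlag_add cc1 ccI.
have [brc brl] := cadlag_add Wc2 cc3.
split; last by move=> t t0; rewrite -brE//= /br /=; ring.
split; first exact: Wc.
- by move=> t t0; apply/cvg_ex; eexists; exact: cv.
- exact: cadlag_ext brE brc.
- move=> s t s0; rewrite le_eqVlt => /predU1P[->//|st].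
  apply/ler_addgt0Pr => h h0.
  have t0 : 0 <= t by exact: (le_trans s0 (ltW st)).
  rewrite -lerBlDr -subr_le0.
  have : (qv_sum (Pi n) W s - h - qv_sum (Pi n) W t) @[n --> \oo] -->
      bracket Pi W s - h - bracket Pi W t.
    apply: cvgB; last by rewrite -brE//; have := cv _ t0; rewrite /br /= mulNr addrA.
    apply: cvgB; last exact: cvg_cst.
    by rewrite -brE//; have := cv _ s0; rewrite /br /= mulNr addrA.
  move=> /cvgr_to_le; apply.
  have := qv_sum_almost_increasing hPi hmesh Wc s0 st h0.
  by apply: filterS => n; rewrite subr_le0.
- move=> t t0; rewrite /jump -(left_limit_ext brE brc t0) -brE//.
  rewrite brl// Wl2// cl3// cl1 clI// cl2 Ij// /br /jump /=; ring.
Qed.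

(** * Local fields *)

(** The bound on the derivative is only required between [x] and [y], so that it
    may depend on the distance to [x]; this is what Taylor's formula needs. *)
Lemma dist_le_of_derivative {R : realType} (g dg : R -> R) (x0 r : R)
    {B x y : R} :
  (forall z, `|z - x0| < r -> is_derive z 1 g (dg z)) ->
  `|x - x0| < r -> `|y - x0| < r ->
  (forall z, `|z - x0| < r -> `|z - x| <= `|y - x| -> `|dg z| <= B) ->
  `|g y - g x| <= B * `|y - x|.
Proof.
move=> gd xr yr gb.
have inb u v z : `|u - x0| < r -> `|v - x0| < r -> u <= z <= v -> `|z - x0| < r.
  rewrite !ltr_norml => /andP[? ?] /andP[? ?] /andP[? ?].
  by apply/andP; split; lra.
have mvt u v : `|u - x0| < r -> `|v - x0| < r -> u < v ->
    exists2 z, u <= z <= v & g v - g u = dg z * (v - u).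
  move=> ur vr uv.
  have [z|z uzv|z zuv ->] := @MVT R g dg u v uv.
  - by rewrite in_itv/= => /andP[uz zv]; apply/gd/(inb u v); rewrite ?ltW.
  - apply: (@derivable_within_continuous _ _ g `[u, v]) z uzv => w.
    by rewrite in_itv/= => wuv; have [] := gd w (inb _ _ _ ur vr wuv).
  - by exists z => //; move: zuv; rewrite in_itv/= => /andP[/ltW -> /ltW].
have [xy|yx|->] := ltgtP x y; last by rewrite !subrr normr0 mulr0.
  have [z /andP[xz zy] ->] := mvt _ _ xr yr xy.
  rewrite normrM ler_wpM2r// gb//; first by apply: (inb x y); rewrite ?xz.
  by rewrite !ger0_norm ?subr_ge0 ?lerD2r// ltW.
have [z /andP[yz zx] E] := mvt _ _ yr xr yx.
rewrite distrC E normrM [in leRHS]distrC ler_wpM2r// gb//.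
  by apply: (inb y x); rewrite ?yz.
by rewrite [`|z - x|]distrC [`|y - x|]distrC !ger0_norm ?subr_ge0 ?lerD2l ?lerN2// ltW.
Qed.

Lemma exists_primitive {R : realType} {f : R -> R} {x0 r r' : R} :
  0 < r' -> r' < r -> (forall x, `|x - x0| < r -> {for x, continuous f}) ->
  exists h : R -> R, h x0 = 0 /\
    forall x, `|x - x0| < r' -> is_derive x 1 h (f x).
Proof.
move=> r0 rr fc; pose lo := x0 - r'; pose hi := x0 + r'.
pose F x :=
  (\int[lebesgue_measure]_(t in [set` Interval (BLeft lo) (BRight x)]) (f t))%R.
exists (fun x => F x - F x0); split; first exact: subrr.
move=> x; rewrite ltr_norml => /andP[x1 x2].
have xhi : x < hi by rewrite /hi; lra.
have lox : lo < x by rewrite /lo; lra.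
have fi : lebesgue_measure.-integrable
    [set` Interval (BLeft lo) (BRight hi)] (EFin \o f).
  apply: continuous_compact_integrable; first exact: segment_compact.
  apply: continuous_in_subspaceT => z; rewrite inE /= in_itv /= => /andP[z1 z2].
  apply: fc; rewrite ltr_norml; move: z1 z2; rewrite /lo /hi => ? ?.
  by apply/andP; split; lra.
have fx : {for x, continuous f}.
  by apply: fc; rewrite ltr_norml; apply/andP; split; lra.
have [Fd Fx] := continuous_FTC1_closed xhi fi lox fx.
have Fis : is_derive x 1 F (f x) by rewrite -Fx derive1E; exact: DeriveDef.
by rewrite -[f x]subr0; apply: is_deriveB.
Qed.

(** [phi s] is, for each time [s], a function of the space variable near [x0]
    whose derivative at [X s] is the integrand.  Its second derivative is nearly
    the constant [c], expressed by difference quotients of [dphi], and its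
    dependence on time is nearly that of the path [L], uniformly in space.  The
    precision [e] and the bound [M] are separate because the first has to be
    made small for a fixed value of the second. *)
Record local_field {R : realType} (X a xi : R -> R) (I : set R) (e M : R)
    (phi dphi : R -> R -> R) (x0 r : R) (L : R -> R) (c : R) : Prop := LocalField {
  field_r : 0 < r <= e;
  field_X : forall s, I s -> `|X s - x0| < r;
  field_derive : forall s x, I s -> `|x - x0| < r ->
    is_derive x 1 (phi s) (dphi s x);
  field_xi : forall s, I s -> dphi s (X s) = xi s;
  field_c : `|c| <= M;
  field_dphi : forall s x, I s -> `|x - x0| < r -> `|dphi s x| <= M;
  field_ddphi : forall s x y, I s -> `|x - x0| < r -> `|y - x0| < r ->
    `|dphi s y - dphi s x - c * (y - x)| <= e * `|y - x|;
  field_time : forall s t x, I s -> I t -> s <= t -> `|x - x0| < r ->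
    `|phi t x - phi s x - (L t - L s)| <= e * (a t - a s);
  field_L : forall s t, I s -> I t -> s <= t -> `|L t - L s| <= M * (a t - a s) }.

Lemma local_field_le {R : realType} {X a a' xi : R -> R} {I I' : set R}
    {e e' M M' : R} {phi dphi x0 r r' L c} :
  local_field X a xi I e M phi dphi x0 r L c ->
  0 <= e -> 0 <= M -> e <= e' -> M <= M' -> 0 < r' -> r' <= r ->
  I' `<=` I -> (forall s, I' s -> `|X s - x0| < r') ->
  (forall s t, I' s -> I' t -> s <= t -> 0 <= a t - a s <= a' t - a' s) ->
  local_field X a' xi I' e' M' phi dphi x0 r' L c.
Proof.
move=> [/andP[r0 re] fX fd fxi fc fb fdd ft fL] e0 M0 ee MM r'0 rr II IX aa.
have br x : `|x - x0| < r' -> `|x - x0| < r by move=> /lt_le_trans; apply.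
split.
- by rewrite r'0 (le_trans rr)// (le_trans re).
- by [].
- by move=> s x Is xr; apply: fd; [exact: II|exact: br].
- by move=> s Is; apply: fxi; exact: II.
- exact: le_trans MM.
- by move=> s x Is xr; apply: le_trans MM; apply: fb; [exact: II|exact: br].
- move=> s x y Is xr yr; apply: (le_trans (fdd s x y (II _ Is) (br _ xr) (br _ yr))).
  exact: ler_wpM2r.
- move=> s t x Is It st xr.
  apply: (le_trans (ft s t x (II _ Is) (II _ It) st (br _ xr))).
  by have /andP[? ?] := aa _ _ Is It st; exact: ler_pM.
- move=> s t Is It st; apply: (le_trans (fL s t (II _ Is) (II _ It) st)).
  by have /andP[? ?] := aa _ _ Is It st; exact: ler_pM.
Qed.

(** Taylor's formula of order two, without a second derivative: the remainder
    [psi] has a derivative of size [e * `|z - x|]. *)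
Lemma local_field_increment {R : realType} {X a xi : R -> R} {I : set R}
    {e M : R} {phi dphi x0 r L c s x y} :
  local_field X a xi I e M phi dphi x0 r L c -> I s -> 0 <= e ->
  `|x - x0| < r -> `|y - x0| < r ->
  `|phi s y - phi s x - dphi s x * (y - x) - c / 2 * (y - x) ^+ 2|
    <= e * (y - x) ^+ 2 /\ `|phi s y - phi s x| <= M * `|y - x|.
Proof.
move=> [/andP[r0 re] fX fd fxi fc fb fdd ft fL] Is e0 xr yr; split; last first.
  apply: (dist_le_of_derivative _ (dphi s) x0 r) => // z zr; first exact: fd.
  by move=> _; exact: fb.
pose psi z := phi s z - dphi s x * (z - x) - c / 2 * (z - x) ^+ 2.
pose dpsi z := dphi s z - dphi s x - c * (z - x).
have psid z : `|z - x0| < r -> is_derive z 1 psi (dpsi z).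
  move=> zr; have ? := fd s z Is zr; rewrite /psi /dpsi.
  by apply: is_derive_eq; rewrite /GRing.scale /=; field.
have -> : phi s y - phi s x - dphi s x * (y - x) - c / 2 * (y - x) ^+ 2 =
    psi y - psi x.
  by rewrite /psi; ring.
have -> : e * (y - x) ^+ 2 = e * `|y - x| * `|y - x|.
  by rewrite -mulrA -normrM ger0_norm -expr2// sqr_ge0.
apply: (dist_le_of_derivative _ dpsi x0 r) => // z zr zx.
by rewrite /dpsi; apply: (le_trans (fdd _ _ _ Is xr zr)); exact: ler_wpM2l.
Qed.

(** Ito's formula for germs: the increment of [phi t (X t)] is the sum of a time
    increment at fixed space point and a space increment at fixed time. *)
Lemma germ_approx_of_field {R : realType} {X a xi : R -> R} {I : set R}
    {e M : R} {phi dphi x0 r L c} :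
  local_field X a xi I e M phi dphi x0 r L c -> 0 <= e -> 0 <= M ->
  (forall s t, I s -> I t -> s <= t -> 0 <= a t - a s) ->
  germ_approx X a (ito_germ xi X) I e (fun t => phi t (X t) - L t)
    (- (c / 2)) (M + e).
Proof.
move=> fld e0 M0 aa.
have [_ fX _ fxi _ _ _ ft _] := fld.
split=> s t Is It st.
  have [H _] := local_field_increment fld Is e0 (fX _ Is) (fX _ It).
  have H' := ft s t (X t) Is It st (fX _ It).
  rewrite /ito_germ -fxi//.
  move: H H'; clear; rewrite !ler_norml => /andP[? ?] /andP[? ?].
  by apply/andP; split; lra.
have [_ H] := local_field_increment fld Is e0 (fX _ Is) (fX _ It).
have H' := ft s t (X t) Is It st (fX _ It).
have := mulr_ge0 e0 (normr_ge0 (X t - X s)).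
have := mulr_ge0 M0 (aa s t Is It st).
move: H H'; clear; rewrite !ler_norml => /andP[? ?] /andP[? ?] ? ?.
by apply/andP; split; lra.
Qed.

(** * The integral of one path against another *)

Lemma normM_le {R : realType} {x y u v : R} : `|x| <= u -> `|y| <= v ->
  `|x * y| <= u * v.
Proof. by move=> xu yv; rewrite normrM ler_pM. Qed.

Lemma field_oscillation {R : realType} {X a xi : R -> R} {I : set R}
    {e M : R} {phi dphi x0 r L c y0 z0 s x} :
  local_field X a xi I e M phi dphi x0 r L c -> 0 <= e -> e <= 1 -> 1 <= M ->
  I s -> `|x - x0| < r -> `|phi s (X s)| <= M -> `|phi s (X s) - y0| <= e ->
  `|xi s - z0| <= e ->
  [/\ `|phi s x| <= 3 * M, `|phi s x - y0| <= 3 * M * e &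
      `|dphi s x - z0| <= 5 * M * e].
Proof.
move=> fld e0 e1 M1 Is xr Yb Yy xiz.
have [/andP[r0 re] fX _ fxi fc _ fdd _ _] := fld.
have Xr := fX _ Is.
have xX : `|x - X s| <= 2 * e.
  move: Xr xr re; clear; rewrite !ltr_norml !ler_norml => /andP[? ?] /andP[? ?] ?.
  by apply/andP; split; lra.
have [_ p1] := local_field_increment fld Is e0 Xr xr.
have p2 := fdd _ _ _ Is Xr xr; rewrite fxi// in p2.
have M0 : 0 <= M by lra.
have p3 : M * `|x - X s| <= 2 * M * e.
  by rewrite [2 * M]mulrC -mulrA; exact: ler_wpM2l.
have p4 : `|c * (x - X s)| <= M * (2 * e) by exact: normM_le.
have p5 : e * `|x - X s| <= 1 * (2 * e) by exact: ler_pM.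
have p6 : e <= M * e by rewrite ler_peMl.
have p7 : M * e <= M by rewrite ler_piMr.
move: p1 p2 p3 p4 p5 p6 p7 Yb Yy xiz; clear; rewrite !ler_norml.
move=> /andP[? ?] /andP[? ?] ? /andP[? ?] ? ? ? /andP[? ?] /andP[? ?] /andP[? ?].
by split; apply/andP; split; lra.
Qed.

Lemma continuous_of_dist_le {R : realType} {f : R -> R} (x0 r B : R) {x : R} :
  `|x - x0| < r -> 0 <= B ->
  (forall y, `|y - x0| < r -> `|f y - f x| <= B * `|y - x|) ->
  {for x, continuous f}.
Proof.
move=> xr B0 H; apply/cvgrPdist_lt => h h0.
have rx : 0 < r - `|x - x0| by rewrite subr_gt0.
exists (Num.min (r - `|x - x0|) (h / (B + 1))) => /=.
  by rewrite lt_min rx divr_gt0//; lra.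
move=> y /=; rewrite lt_min => /andP[y1 y2].
rewrite distrC; apply: (le_lt_trans (H y _)).
  by have := ler_distD x y x0; rewrite [`|y - x|]distrC; move: y1; clear; lra.
rewrite distrC; apply: (le_lt_trans (_ : _ <= B * (h / (B + 1)))).
  by rewrite ler_wpM2l// ltW.
by rewrite mulrA ltr_pdivrMr; [rewrite mulrDr; lra|lra].
Qed.

(** The field of [Y * eta] is the primitive [h s] of [phi s * dgam s] with
    [h s x0 = 0].  For its time increment, the auxiliary function
    [k = (h t - h s) - phi s * (gam t - gam s)] has derivative
    [(phi t - phi s) * dgam t - dphi s * (gam t - gam s)], which contains no
    time increment of [dgam] and is of the order of [a t - a s]; as the ball
    is small, so is the variation of [k]. *)
Lemma local_field_mul {R : realType} {X a Y xi eta : R -> R} {I : set R}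
    {e M : R} {phi dphi gam dgam x0 r r' L1 L2 c1 c2 y0 z0 g0} :
  local_field X a xi I e M phi dphi x0 r L1 c1 ->
  local_field X a eta I e M gam dgam x0 r L2 c2 ->
  0 <= e -> e <= 1 -> 1 <= M -> 0 < r' -> r' < r ->
  (forall s, I s -> `|X s - x0| < r') ->
  (forall s t, I s -> I t -> s <= t -> 0 <= a t - a s) ->
  (forall s, I s -> phi s (X s) = Y s) ->
  (forall s, I s -> [/\ `|Y s| <= M, `|Y s - y0| <= e, `|xi s - z0| <= e &
     `|eta s - g0| <= e /\ `|gam s (X s)| <= M]) ->
  `|y0| <= M -> `|z0| <= M -> `|g0| <= M ->
  exists h, local_field X a (Y \* eta) I (21 * (M * M) * e) (3 * (M * M))
    h (fun s x => phi s x * dgam s x) x0 r' (fun=> 0) (y0 * c2 + z0 * g0).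
Proof.
move=> F1 F2 e0 e1 M1 r'0 rr X' ainc phiX bnd y0M z0M g0M.
have M0 : 0 <= M by lra.
have MM : M <= M * M by rewrite ler_peMl.
have [/andP[r0 re] _ fd1 _ fc1 fb1 _ ft1 fL1] := F1.
have [_ _ fd2 fxi2 fc2 fb2 fdd2 ft2 fL2] := F2.
have osc1 s x : I s -> `|x - x0| < r -> [/\ `|phi s x| <= 3 * M,
    `|phi s x - y0| <= 3 * M * e & `|dphi s x - z0| <= 5 * M * e].
  move=> Is xr; have [b1 b2 b3 _] := bnd _ Is.
  by apply: (field_oscillation F1); rewrite ?phiX.
have osc2 s x : I s -> `|x - x0| < r -> `|dgam s x - g0| <= 5 * M * e.
  move=> Is xr; have [_ _ _ [b1 b2]] := bnd _ Is.
  have gg : `|gam s (X s) - gam s (X s)| <= e by rewrite subrr normr0.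
  by have [] := field_oscillation F2 e0 e1 M1 Is xr b2 gg b1.
have fcont s x : I s -> `|x - x0| < r ->
    {for x, continuous (fun x => phi s x * dgam s x)}.
  move=> Is xr; apply: continuousM.
    apply: differentiable_continuous; apply/derivable1_diffP.
    by have [] := fd1 s x Is xr.
  apply: (continuous_of_dist_le x0 r (M + e)) => //; first lra.
  move=> y yr; have := fdd2 s x y Is xr yr.
  have : `|c2 * (y - x)| <= M * `|y - x| by exact: normM_le.
  rewrite mulrDl; clear; rewrite !ler_norml => /andP[? ?] /andP[? ?].
  by apply/andP; split; lra.
have /choice[h hP] : forall s, exists h : R -> R, I s -> h x0 = 0 /\
    forall x, `|x - x0| < r' -> is_derive x 1 h (phi s x * dgam s x).
  move=> s; have [Is|nIs] := pselect (I s); last by exists (fun=> 0).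
  have [h hh] := exists_primitive r'0 rr (fun x => fcont s x Is).
  by exists h.
exists h.
have wide x : `|x - x0| < r' -> `|x - x0| < r by move/lt_trans; apply.
split.
- rewrite r'0 (le_trans (ltW rr))// (le_trans re)// ler_peMl//.
  by move: MM M1; clear; lra.
- by [].
- by move=> s x Is xr; have [_] := hP _ Is; apply.
- by move=> s Is; rewrite phiX ?fxi2.
- have p1 : `|y0 * c2| <= M * M by exact: normM_le.
  have p2 : `|z0 * g0| <= M * M by exact: normM_le.
  move: p1 p2 MM M1; clear; rewrite !ler_norml => /andP[? ?] /andP[? ?] ? ?.
  by apply/andP; split; lra.
- move=> s x Is /wide xr; have [b1 _ _] := osc1 s x Is xr.
  by rewrite mulrA; apply: normM_le => //; exact: fb2.
- move=> s x y Is /wide xr /wide yr.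
  have [b1 b2 _] := osc1 s y Is yr; have b3 := osc2 s x Is xr.
  set D := `|y - x|.
  have D0 : 0 <= D by exact: normr_ge0.
  have q1 : `|phi s y * (dgam s y - dgam s x - c2 * (y - x))| <= 3 * M * (e * D).
    by apply: normM_le => //; exact: fdd2.
  have q2 : `|(phi s y - y0) * (c2 * (y - x))| <= (3 * M * e) * (M * D).
    by apply: normM_le => //; exact: normM_le.
  have q3 : `|(phi s y - phi s x - z0 * (y - x)) * dgam s x| <= 5 * M * e * D * M.
    apply: normM_le; last exact: fb2.
    have -> : phi s y - phi s x - z0 * (y - x) =
      (phi s y - z0 * y) - (phi s x - z0 * x) by ring.
    apply: (dist_le_of_derivative (fun z => phi s z - z0 * z)
      (fun z => dphi s z - z0) x0 r) => // z zr.
      have ? := fd1 s z Is zr; apply: is_derive_eq.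
      by rewrite /GRing.scale /=; ring.
    by move=> _; have [] := osc1 s z Is zr.
  have q4 : `|z0 * ((dgam s x - g0) * (y - x))| <= M * (5 * M * e * D).
    by apply: normM_le => //; apply: normM_le.
  have -> : phi s y * dgam s y - phi s x * dgam s x - (y0 * c2 + z0 * g0) * (y - x)
    = phi s y * (dgam s y - dgam s x - c2 * (y - x)) +
      (phi s y - y0) * (c2 * (y - x)) +
      (phi s y - phi s x - z0 * (y - x)) * dgam s x +
      z0 * ((dgam s x - g0) * (y - x)) by ring.
  have q5 : M * (e * D) <= M * M * (e * D) by apply: ler_wpM2r => //; exact: mulr_ge0.
  have q6 : 0 <= M * M * (e * D) by do ?apply: mulr_ge0.
  move: q1 q2 q3 q4 q5 q6; clear; rewrite !ler_norml.
  move=> /andP[? ?] /andP[? ?] /andP[? ?] /andP[? ?] ? ?; apply/andP; split; lra.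
- move=> s t x Is It st xr'.
  have xr := wide _ xr'.
  have x0r' : `|x0 - x0| < r' by rewrite subrr normr0.
  have x0r := wide _ x0r'.
  set D := a t - a s; have D0 : 0 <= D by exact: ainc.
  have eD : e * D <= M * D by rewrite ler_wpM2r// (le_trans e1).
  have gap1 z : `|z - x0| < r -> `|phi t z - phi s z| <= 2 * M * D.
    move=> zr; have := ft1 s t z Is It st zr; have := fL1 s t Is It st.
    move: eD; rewrite -/D; clear; rewrite !ler_norml => ? /andP[? ?] /andP[? ?].
    by apply/andP; split; lra.
  have gap2 z : `|z - x0| < r -> `|gam t z - gam s z| <= 2 * M * D.
    move=> zr; have := ft2 s t z Is It st zr; have := fL2 s t Is It st.
    move: eD; rewrite -/D; clear; rewrite !ler_norml => ? /andP[? ?] /andP[? ?].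
    by apply/andP; split; lra.
  (* Both [h t] and [h s] vanish at [x0], so [h t x - h s x] is recovered from
   [k x - k x0]. *)
  pose k z := h t z - h s z - phi s z * (gam t z - gam s z).
  pose dk z := (phi t z - phi s z) * dgam t z - dphi s z * (gam t z - gam s z).
  have kb : `|k x - k x0| <= 4 * (M * M) * D * `|x - x0|.
    apply: (dist_le_of_derivative k dk x0 r') => // z zr'.
      have zr := wide _ zr'.
      have ? := fd1 s z Is zr; have ? := fd2 s z Is zr; have ? := fd2 t z It zr.
      have ? := (hP s Is).2 z zr'; have ? := (hP t It).2 z zr'.
      apply: is_derive_eq; rewrite /dk /GRing.scale /=; ring.
    move=> _; have zr := wide _ zr'; rewrite /dk.
    have p1 : `|(phi t z - phi s z) * dgam t z| <= 2 * M * D * M.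
      by apply: normM_le; [exact: gap1|exact: fb2].
    have p2 : `|dphi s z * (gam t z - gam s z)| <= M * (2 * M * D).
      by apply: normM_le; [exact: fb1|exact: gap2].
    move: p1 p2; clear; rewrite !ler_norml => /andP[? ?] /andP[? ?].
    by apply/andP; split; lra.
  have rx : `|x - x0| <= e by exact: (le_trans (ltW xr)).
  have {}kb : `|k x - k x0| <= 4 * (M * M) * D * e.
    by apply: (le_trans kb); rewrite ler_wpM2l// !mulr_ge0.
  have q1 : `|(phi s x - phi s x0) * (gam t x - gam s x)| <= M * e * (2 * M * D).
    apply: normM_le; last exact: gap2.
    have [_ p] := local_field_increment F1 Is e0 x0r xr.
    by apply: (le_trans p); rewrite ler_wpM2l.
  have q2 : `|phi s x0 * ((gam t x - gam s x) - (gam t x0 - gam s x0))|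
      <= 3 * M * (2 * e * D).
    apply: normM_le; first by have [] := osc1 s x0 Is x0r.
    have := ft2 s t x Is It st xr; have := ft2 s t x0 Is It st x0r.
    rewrite -/D; clear; rewrite !ler_norml => /andP[? ?] /andP[? ?].
    by apply/andP; split; lra.
  have -> : h t x - h s x - (0 - 0) = (k x - k x0) +
     (phi s x - phi s x0) * (gam t x - gam s x) +
     phi s x0 * ((gam t x - gam s x) - (gam t x0 - gam s x0)).
    by rewrite /k (hP s Is).1 (hP t It).1; ring.
  have q5 : M * (e * D) <= M * M * (e * D) by apply: ler_wpM2r => //; exact: mulr_ge0.
  have q6 : 0 <= M * M * (e * D) by do ?apply: mulr_ge0.
  move: kb q1 q2 q5 q6; clear; rewrite !ler_norml.
  move=> /andP[? ?] /andP[? ?] /andP[? ?] ? ?; apply/andP; split; lra.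
- move=> s t Is It st; rewrite subrr normr0 !mulr_ge0//; exact: ainc.
Qed.

(** [Y s * (Z t - Z s)] is [Y s * eta s * (X t - X s)], to which the product
    field applies, plus [Y s] times the Ito remainder of [Z]; in the latter
    [Y s] may be replaced by the constant [y0]. *)
Lemma germ_approx_of_path_field {R : realType} {X a Y Z xi eta : R -> R}
    {I : set R}
    {e M : R} {phi dphi gam dgam x0 r r' L1 L2 c1 c2 y0 z0 g0} :
  local_field X a xi I e M phi dphi x0 r L1 c1 ->
  local_field X a eta I e M gam dgam x0 r L2 c2 ->
  0 <= e -> e <= 1 -> 1 <= M -> 0 < r' -> r' < r ->
  (forall s, I s -> `|X s - x0| < r') ->
  (forall s t, I s -> I t -> s <= t -> 0 <= a t - a s) ->
  (forall s, I s -> phi s (X s) = Y s) -> (forall s, I s -> gam s (X s) = Z s) ->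
  (forall s, I s -> [/\ `|Y s| <= M, `|Y s - y0| <= e, `|xi s - z0| <= e,
     `|eta s - g0| <= e & `|Z s| <= M]) ->
  `|y0| <= M -> `|z0| <= M -> `|g0| <= M ->
  exists K c N, 0 <= N /\
    germ_approx X a (ito_germ Y Z) I (24 * (M * M) * e) K c N.
Proof.
move=> F1 F2 e0 e1 M1 r'0 rr X' ainc phiX gamX bnd y0M z0M g0M.
have M0 : 0 <= M by lra.
have MM : M <= M * M by rewrite ler_peMl.
have [h Fh] : exists h, local_field X a (Y \* eta) I (21 * (M * M) * e) (3 * (M * M))
    h (fun s x => phi s x * dgam s x) x0 r' (fun=> 0) (y0 * c2 + z0 * g0).
  apply: (local_field_mul F1 F2) => //.
  by move=> s Is; have [? ? ? ? ?] := bnd s Is; rewrite gamX.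
have eh0 : 0 <= 21 * (M * M) * e by rewrite !mulr_ge0.
have [Hh Kh] := germ_approx_of_field Fh eh0
  (mulr_ge0 (ler0n _ 3) (mulr_ge0 M0 M0)) ainc.
have [Hg Kg] := germ_approx_of_field F2 e0 M0 ainc.
have [_ _ _ _ fc2 _ _ _ fL2] := F2.
exists (fun t => h t (X t) + y0 * L2 t), (- ((y0 * c2 + z0 * g0) / 2) + y0 * (c2 / 2)).
exists (3 * (M * M) + 21 * (M * M) * e + M * M).
have Meh : 0 <= 3 * (M * M) + 21 * (M * M) * e by rewrite addr_ge0// !mulr_ge0.
split; first by rewrite addr_ge0// mulr_ge0.
split=> s t Is It st.
  have H1 := Hh s t Is It st; have H2 := Hg s t Is It st.
  have [Ys Yy _ _ _] := bnd s Is.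
  have Da := ainc s t Is It st.
  have Dx := sqr_ge0 (X t - X s).
  have w0 : 0 <= a t - a s + (X t - X s) ^+ 2 by exact: addr_ge0.
  have p1 : `|Y s * (ito_germ eta X s t - (gam t (X t) - L2 t - (gam s (X s) - L2 s))
      - - (c2 / 2) * (X t - X s) ^+ 2)| <= M * (e * (a t - a s + (X t - X s) ^+ 2)).
    exact: normM_le.
  have p2 : `|(Y s - y0) * (L2 t - L2 s)| <= e * (M * (a t - a s)).
    by apply: normM_le => //; exact: fL2.
  have p3 : `|(Y s - y0) * (c2 / 2 * (X t - X s) ^+ 2)| <= e * (M * (X t - X s) ^+ 2).
    apply: normM_le => //; apply: normM_le; last by rewrite ger0_norm.
    by move: fc2; clear; rewrite !ler_norml => /andP[? ?]; apply/andP; split; lra.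
  have p4 : M * (e * (a t - a s + (X t - X s) ^+ 2)) <=
     M * M * (e * (a t - a s + (X t - X s) ^+ 2)).
    by apply: ler_wpM2r => //; exact: mulr_ge0.
  have p5 : 0 <= M * M * (e * (a t - a s + (X t - X s) ^+ 2)) by rewrite !mulr_ge0.
  rewrite /= in H1 *; move: H1 p1 p2 p3 p4 p5; rewrite !gamX// /ito_germ /=.
  clear; rewrite !ler_norml.
  move=> /andP[? ?] /andP[? ?] /andP[? ?] /andP[? ?] ? ?; apply/andP; split; lra.
have H1 := Kh s t Is It st; have H2 := fL2 s t Is It st.
have p1 : `|y0 * (L2 t - L2 s)| <= M * (M * (a t - a s)) by exact: normM_le.
have p2 : 0 <= M * M * `|X t - X s| by rewrite !mulr_ge0.
move: H1 p1 p2 => /=; clear; rewrite !ler_norml.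
move=> /andP[? ?] /andP[? ?] ?; apply/andP; split; lra.
Qed.

(** * Paths that are locally functions of [X] *)

Definition has_fields {R : realType} (X a xi : R -> R) (t : R) : Prop :=
  forall b, exists2 M, 0 <= M & forall e, 0 < e -> exists2 d, 0 < d &
    exists phi dphi r L c,
      local_field X a xi (half_nbhd b t d) e M phi dphi (side_value b X t) r L c.

Definition has_path_fields {R : realType} (X a Y xi : R -> R) (t : R) : Prop :=
  forall b, exists2 M, 0 <= M & forall e, 0 < e -> exists2 d, 0 < d &
    exists phi dphi r L c,
      local_field X a xi (half_nbhd b t d) e M phi dphi (side_value b X t) r L c /\
      forall s, half_nbhd b t d s -> phi s (X s) = Y s.

Lemma increasing_path_increment_ge0 {R : realType} {a : R -> R} {b} {tau d : R} :
  increasing_path a -> forall s t, half_nbhd b tau d s -> half_nbhd b tau d t ->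
  s <= t -> 0 <= a t - a s.
Proof. by move=> [_ ainc] s t [s0 _] _ st; rewrite subr_ge0; exact: ainc. Qed.

Lemma half_nbhd_convex {R : realType} {b} {tau d s t u : R} :
  half_nbhd b tau d s -> half_nbhd b tau d t -> s <= u <= t -> half_nbhd b tau d u.
Proof.
move=> [s0 sd] [t0 td] /andP[su ut]; split; first exact: le_trans su.
case: b sd td => /andP[s1 s2] /andP[t1 t2]; apply/andP; split.
- exact: le_trans su.
- exact: le_lt_trans t2.
- exact: lt_le_trans su.
- exact: le_lt_trans t2.
Qed.

Lemma increasing_pathD {R : realType} {a b : R -> R} :
  increasing_path a -> increasing_path b -> increasing_path (a \+ b).
Proof.
move=> [ac ai] [bc bi]; split; first by have [] := cadlag_add ac bc.
by move=> s t s0 st; rewrite lerD//; [exact: ai|exact: bi].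
Qed.

Lemma locally_approx_of_fields {R : realType} {X a xi : R -> R} {t : R} :
  increasing_path a -> has_fields X a xi t ->
  locally_approx X a (ito_germ xi X) t.
Proof.
move=> ha H b e e0; have [M M0 {}H] := H b.
have [d d0 [phi [dphi [r [L [c fld]]]]]] := H e e0.
exists d => //; exists (fun t => phi t (X t) - L t), (- (c / 2)), (M + e).
split; first by rewrite addr_ge0// ltW.
apply: (germ_approx_of_field fld (ltW e0) M0).
exact: increasing_path_increment_ge0.
Qed.

(** On each one-sided neighbourhood [Y s - phi s (X s)] is a path [C] whose
    increments are dominated by those of [a + [X,X] + va], by the local estimate
    on the integral; adding [C s] to [phi s] does not change the space
    derivative, and [C] is absorbed into [L]. *)
Lemma has_path_fields_of_integral {R : realType} (Pi : nat -> nat -> R)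
    {X a va : R -> R} (A : R -> R) {Y xi : R -> R} {t : R} :
  (forall n, is_partition (Pi n)) -> mesh (Pi n) @[n --> \oo] --> 0%E ->
  QV Pi X -> increasing_path a -> increasing_path va -> cadlag xi ->
  ito_regular Pi xi X ->
  (forall s u, 0 <= s -> s <= u -> `|A u - A s| <= va u - va s) ->
  (forall s, 0 <= s -> Y s = ito_integral Pi xi X s + A s) ->
  has_fields X a xi t ->
  has_path_fields X (a \+ bracket Pi X \+ va) Y xi t.
Proof.
move=> hPi hmesh hX ha hva xic [ex _ _] Ava YE H b; have [M M0 {}H] := H b.
have hbr := bracket_increasing hX; have [Xc _ _ _ _] := hX.
exists (2 * M + 2); first by lra.
move=> e e0; pose e1 := Num.min e 1.
have e10 : 0 < e1 by rewrite lt_min e0 ltr01.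
have e11 : e1 <= 1 by rewrite ge_min lexx orbT.
have e1e : e1 <= e by rewrite ge_min lexx.
have [d d0 [phi [dphi [r [L [c fld]]]]]] := H e1 e10.
have fld' : local_field X (a \+ bracket Pi X \+ va) xi (half_nbhd b t d) e
    (2 * M + 2) phi dphi (side_value b X t) r L c.
  have [/andP[r0 _] fX _ _ _ _ _ _ _] := fld.
  apply: (local_field_le fld) => //.
  - exact: ltW.
  - lra.
  - move=> s u Is Iu su; have := increasing_path_increment_ge0 ha _ _ Is Iu su.
    have := increasing_path_increment_ge0 hbr _ _ Is Iu su.
    have := increasing_path_increment_ge0 hva _ _ Is Iu su.
    by rewrite /=; clear => *; apply/andP; split; lra.
have [fr fX fd fxi fc fb fdd ft fL] := fld'.
exists d => //; pose C s := Y s - phi s (X s).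
exists (fun s x => phi s x + C s), dphi, r, (L \+ C), c.
split; last by move=> s Is; rewrite /C; ring.
split => //.
- move=> s x Is xr; have ? := fd s x Is xr.
  by apply: is_derive_eq; rewrite addr0.
- move=> s u x Is Iu su xr /=.
  rewrite (_ : _ - _ = phi u x - phi s x - (L u - L s)); last by ring.
  exact: ft.
move=> s u Is Iu su /=.
have [s0 _] := Is; have u0 : 0 <= u by exact: le_trans su.
have app := germ_approx_of_field fld (ltW e10) M0
  (increasing_path_increment_ge0 ha).
have conv v : s <= v <= u -> half_nbhd b t d v by exact: half_nbhd_convex.
have loc := ito_integral_local hPi hmesh hX ha xic Xc
  (ltW e10) (addr_ge0 M0 (ltW e10)) ex app s0 su conv.
have Da := increasing_path_increment_ge0 ha _ _ Is Iu su.
have Db := increasing_path_increment_ge0 hbr _ _ Is Iu su.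
have Dv := increasing_path_increment_ge0 hva _ _ Is Iu su.
have AA := Ava s u s0 su.
have [_ _ _ _ cM _ _ _ _] := fld.
have p1 : (`|- (c / 2)| + e1) * (a u - a s + (bracket Pi X u - bracket Pi X s)) <=
    (2 * M + 2) * (a u - a s + (bracket Pi X u - bracket Pi X s)).
  apply: ler_wpM2r; first exact: addr_ge0.
  rewrite normrN normrM [`|2^-1|]ger0_norm ?invr_ge0//.
  by move: cM e11 M0; have := normr_ge0 c; clear; lra.
have p2 := mulr_ge0 M0 Dv.
have p3 := mulr_ge0 M0 (addr_ge0 Da Db).
rewrite /C !YE//; move: loc p1 p2 p3 AA Da Db Dv => /=; clear; rewrite !ler_norml.
by move=> /andP[? ?] ? ? ? /andP[? ?] ? ? ?; apply/andP; split; lra.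
Qed.

Lemma has_path_fields_le {R : realType} {X a a' Y xi : R -> R} {t : R} :
  increasing_path a -> increasing_path a' ->
  has_path_fields X a Y xi t -> has_path_fields X (a \+ a') Y xi t.
Proof.
move=> ha ha' H b; have [M M0 {}H] := H b; exists M => // e e0.
have [d d0 [phi [dphi [r [L [c [fld pY]]]]]]] := H e e0.
exists d => //; exists phi, dphi, r, L, c; split => //.
have [/andP[r0 _] fX _ _ _ _ _ _ _] := fld.
apply: (local_field_le fld) => //.
  exact: ltW.
move=> s u Is Iu su; have := increasing_path_increment_ge0 ha _ _ Is Iu su.
have := increasing_path_increment_ge0 ha' _ _ Is Iu su.
by rewrite /=; clear => *; apply/andP; split; lra.
Qed.

Lemma germ_approx_le {R : realType} {X a : R -> R} {E I}
    {e e' : R} {K c M} :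
  (forall s t, I s -> I t -> s <= t -> 0 <= a t - a s) -> e <= e' ->
  germ_approx X a E I e K c M -> germ_approx X a E I e' K c M.
Proof.
move=> ainc ee [H1 H2]; split => // s t Is It st.
apply: (le_trans (H1 s t Is It st)); apply: ler_wpM2r => //.
by rewrite addr_ge0 ?sqr_ge0// ainc.
Qed.

(** The precision [e1] required of the fields depends on the bounds of the
    fields and of the paths: this is why these bounds must be chosen before the
    precision. *)
Lemma locally_approx_of_path_fields {R : realType} {X a Y Z : R -> R}
    (xi eta : R -> R) {t : R} :
  increasing_path a -> cadlag X -> cadlag Y -> cadlag Z -> cadlag xi ->
  cadlag eta -> 0 <= t ->
  has_path_fields X a Y xi t -> has_path_fields X a Z eta t ->
  locally_approx X a (ito_germ Y Z) t.
Proof.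
move=> ha Xc Yc Zc xic etac t0 HY HZ b e e0.
have [M1 M10 {}HY] := HY b; have [M2 M20 {}HZ] := HZ b.
pose y0 := side_value b Y t; pose z0 := side_value b xi t.
pose g0 := side_value b eta t; pose w0 := side_value b Z t.
pose M := 1 + M1 + M2 + (`|y0| + 1) + `|z0| + `|g0| + (`|w0| + 1).
have [ny nz ng nw] := And4 (normr_ge0 y0) (normr_ge0 z0) (normr_ge0 g0) (normr_ge0 w0).
have M1' : 1 <= M by rewrite /M; lra.
have MM0 : 0 < 24 * (M * M) by rewrite !mulr_gt0//; lra.
(* [24 * (M * M)] is the loss of precision in [germ_approx_of_path_field]. *)
pose e1 := Num.min 1 (e / (24 * (M * M))).
have e10 : 0 < e1 by rewrite lt_min ltr01 divr_gt0.
have e11 : e1 <= 1 by rewrite ge_min lexx.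
have e1e : 24 * (M * M) * e1 <= e.
  by rewrite mulrC -ler_pdivlMr// ge_min lexx orbT.
have [d1 d10 [phi [dphi [r1 [L1 [c1 [F1 pY]]]]]]] := HY e1 e10.
have [d2 d20 [gam [dgam [r2 [L2 [c2 [F2 pZ]]]]]]] := HZ e1 e10.
have [/andP[r10 _] _ _ _ _ _ _ _ _] := F1.
have [/andP[r20 _] _ _ _ _ _ _ _ _] := F2.
pose r := Num.min r1 r2; have r0 : 0 < r by rewrite lt_min r10.
have r20' : 0 < r / 2 by lra.
have [d3 /= d30 HX3] := cvg_dist_near (cadlag_cvg b Xc t0) r20'.
have [d4 /= d40 HY4] := cvg_dist_near (cadlag_cvg b Yc t0) e10.
have [d5 /= d50 HZ5] := cvg_dist_near (cadlag_cvg b Zc t0) e10.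
have [d6 /= d60 Hx6] := cvg_dist_near (cadlag_cvg b xic t0) e10.
have [d7 /= d70 He7] := cvg_dist_near (cadlag_cvg b etac t0) e10.
pose d := Num.min d1 (Num.min d2 (Num.min d3 (Num.min d4
  (Num.min d5 (Num.min d6 d7))))).
exists d; first by rewrite !lt_min d10 d20 d30 d40 d50 d60 d70.
have sub dd : d <= dd -> half_nbhd b t d `<=` half_nbhd b t dd by exact: half_nbhd_le.
have ainc s u (Is : half_nbhd b t d s) (Iu : half_nbhd b t d u) (su : s <= u) :=
  increasing_path_increment_ge0 ha _ _ Is Iu su.
have HX3' s : half_nbhd b t d s -> `|X s - side_value b X t| < r / 2.
  by move=> Is; apply: HX3; apply: sub Is; rewrite /d !ge_min lexx !orbT.
have HX3'' s : half_nbhd b t d s -> `|X s - side_value b X t| < r.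
  by move=> /HX3' /lt_trans; apply; lra.
have ainc' s u : half_nbhd b t d s -> half_nbhd b t d u -> s <= u ->
    0 <= a u - a s <= a u - a s.
  by move=> Is Iu su; rewrite lexx andbT ainc.
have F1' : local_field X a xi (half_nbhd b t d) e1 M phi dphi
    (side_value b X t) r L1 c1.
  apply: (local_field_le F1) => //.
  - exact: ltW.
  - by rewrite /M; move: M20 ny nz ng nw; clear; lra.
  - by rewrite /r ge_min lexx.
  - by apply: sub; rewrite /d !ge_min lexx.
have F2' : local_field X a eta (half_nbhd b t d) e1 M gam dgam
    (side_value b X t) r L2 c2.
  apply: (local_field_le F2) => //.
  - exact: ltW.
  - by rewrite /M; move: M10 ny nz ng nw; clear; lra.
  - by rewrite /r ge_min lexx orbT.
  - by apply: sub; rewrite /d !ge_min lexx orbT.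
have yM : `|y0| <= M by rewrite /M; move: M10 M20 ny nz ng nw; clear; lra.
have zM : `|z0| <= M by rewrite /M; move: M10 M20 ny nz ng nw; clear; lra.
have gM : `|g0| <= M by rewrite /M; move: M10 M20 ny nz ng nw; clear; lra.
have rr : r / 2 < r by move: r0; clear; lra.
have pY' s : half_nbhd b t d s -> phi s (X s) = Y s.
  by move=> Is; apply: pY; apply: sub Is; rewrite /d !ge_min lexx.
have pZ' s : half_nbhd b t d s -> gam s (X s) = Z s.
  by move=> Is; apply: pZ; apply: sub Is; rewrite /d !ge_min lexx orbT.
have bnd s : half_nbhd b t d s -> [/\ `|Y s| <= M, `|Y s - y0| <= e1,
    `|xi s - z0| <= e1, `|eta s - g0| <= e1 & `|Z s| <= M].
  move=> Is.
  have p1 : `|Y s - y0| < e1.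
    by apply: HY4; apply: sub Is; rewrite /d !ge_min lexx !orbT.
  have p2 : `|Z s - w0| < e1.
    by apply: HZ5; apply: sub Is; rewrite /d !ge_min lexx !orbT.
  have p3 : `|xi s - z0| < e1.
    by apply: Hx6; apply: sub Is; rewrite /d !ge_min lexx !orbT.
  have p4 : `|eta s - g0| < e1.
    by apply: He7; apply: sub Is; rewrite /d !ge_min lexx !orbT.
  split; try exact: ltW.
    have := lerB_dist (Y s) y0; rewrite /M.
    by move: M10 M20 nz ng nw p1 e11; clear; lra.
  have := lerB_dist (Z s) w0; rewrite /M.
  by move: M10 M20 nz ny ng p2 e11; clear; lra.
have [K [c [N [N0 app]]]] := germ_approx_of_path_field F1' F2' (ltW e10) e11 M1'
  r20' rr HX3' ainc pY' pZ' bnd yM zM gM.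
exists K, c, N; split => //.
exact: germ_approx_le app.
Qed.

(** * Fields of admissible integrands *)

Lemma increasing_path_right {R : realType} {a : R -> R} :
  (forall s t, 0 <= s -> s <= t -> a s <= a t) ->
  (forall t, 0 <= t -> a s @[s --> t^'+] --> a t) -> increasing_path a.
Proof.
move=> ainc ar; split => //; apply: cadlag_of_cvg => t t0.
  exact/half_nbhds_right/ar.
pose S := [set a s | s in [set s | 0 <= s < t]].
have S0 : S (a 0) by exists 0 => //=; rewrite lexx.
have supS : has_sup S.
  split; first by exists (a 0).
  exists (a t) => _ [s /= /andP[s0 st] <-]; apply: ainc => //; exact: ltW.
exists (sup S); apply/cvgrPdist_le => e e0.
have [_ [s /= /andP[s0 st] <-] se] := sup_adherent e0 supS.
exists (t - s); first by rewrite /= subr_gt0.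
move=> u [u0 /andP[us ut]].
have : a s <= a u by apply: ainc => //; lra.
have : a u <= sup S.
  by apply: ub_le_sup; [exact: supS.2|exists u => //=; rewrite u0].
by move: se; clear => *; rewrite ler_norml; apply/andP; split; lra.
Qed.

Lemma FVloc_variation {R : realType} {A : R -> R} : FVloc A ->
  exists2 v, increasing_path v &
    forall s t, 0 <= s -> s <= t -> `|A t - A s| <= v t - v s.
Proof.
move=> [[Ar _] Abv].
have bv t : 0 <= t -> bounded_variation 0 t A.
  rewrite le_eqVlt => /predU1P[<-|]; last exact: Abv.
  by apply/bounded_variationP => //; rewrite total_variationxx.
pose v t := fine (total_variation 0 t A).
have fin t : 0 <= t -> total_variation 0 t A \is a fin_num.
  by move=> t0; apply/bounded_variationP => //; exact: bv.
have key s t : 0 <= s -> s <= t -> `|A t - A s| <= v t - v s.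
  move=> s0 st; have t0 : 0 <= t by exact: le_trans st.
  have E := @total_variationD R 0 t s A s0 st.
  have := fin t t0; rewrite E fin_numD => /andP[f1 f2].
  have -> : v t - v s = fine (total_variation s t A).
    by rewrite /v E fineD// addrAC subrr add0r.
  rewrite -lee_fin fineK//.
  exact: total_variation_ge.
exists v => //; apply: increasing_path_right => [s t s0 st|t t0].
  by rewrite -subr_ge0; apply: le_trans (key _ _ s0 st).
have t1 : t < t + 1 by lra.
apply: (total_variation_right_continuous t0 t1 (Ar _ t0)).
by apply: bv; lra.
Qed.

Lemma increasing_path_sum {R : realType} {m} {v : 'I_m -> R -> R} :
  (forall i, increasing_path (v i)) -> increasing_path (fun t => \sum_i v i t).
Proof.
move=> hv; split; last first.
  by move=> s t s0 st; apply: ler_sum => i _; exact: (hv i).2.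
suff H r : cadlag (fun t => \sum_(i <- r) v i t) by exact: H.
elim: r => [|i r IH].
  by under eq_fun do rewrite big_nil; have [] := cadlag_cst (0 : R).
under eq_fun do rewrite big_cons.
by have [] := cadlag_add (hv i).1 IH.
Qed.

Lemma is_derive_along {R : realType} {V : normedModType R} {F : V -> R}
    {w : R -> V} {v : V} {y : R} : (forall h, w (h + y) = h *: v + w y) ->
  derivable F (w y) v -> is_derive y 1 (fun z => F (w z)) ('D_v F (w y)).
Proof.
move=> wE Fd.
have E : (fun h : R => h^-1 *: (((fun z => F (w z)) \o shift y) (h *: 1) - F (w y))) =
         (fun h : R => h^-1 *: ((F \o shift (w y)) (h *: v) - F (w y))).
  by apply/funext => h; rewrite /= /GRing.scale /= mulr1 wE.
by apply: DeriveDef; rewrite /derivable /derive E.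
Qed.

(** Continuity of the partial derivatives gives strict differentiability: [u] is
    changed into [v] one coordinate at a time, so that all intermediate points
    stay in the box where the partial derivatives are controlled. *)
Lemma increment_partials {R : realType} {m} {F : 'rV[R]_m -> R} {p0 : 'rV[R]_m}
    {r e : R} {g : 'I_m -> R} {u v : 'rV[R]_m} :
  (forall (w : 'rV[R]_m) i, (forall j, `|w 0 j - p0 0 j| < r) ->
     derivable F w (delta_mx 0 i) /\ `|'D_(delta_mx 0 i) F w - g i| <= e) ->
  (forall j, `|u 0 j - p0 0 j| < r) -> (forall j, `|v 0 j - p0 0 j| < r) ->
  `|F v - F u - \sum_i g i * (v 0 i - u 0 i)| <= e * \sum_i `|v 0 i - u 0 i|.
Proof.
move=> HF ur vr.
pose w (k : nat) : 'rV[R]_m := \row_i (if (i < k)%N then v 0 i else u 0 i).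
have wm : w m = v by apply/rowP => i; rewrite mxE ltn_ord.
have w0 : w 0%N = u by apply/rowP => i; rewrite mxE.
have -> : F v - F u = \sum_(i < m) (F (w i.+1) - F (w i)).
  by rewrite -(big_mkord xpredT (fun i => F (w i.+1) - F (w i))) telescope_sumr// wm w0.
rewrite -sumrB mulr_sumr; apply: le_trans (ler_norm_sum _ _ _) _.
apply: ler_sum => i _.
(* Coordinates before [i] are already those of [v], and those after [i] still
   those of [u]. *)
pose wi (y : R) : 'rV[R]_m :=
  \row_j (if (j < i)%N then v 0 j else if j == i then y else u 0 j).
have -> : w i = wi (u 0 i).
  apply/rowP => j; rewrite !mxE; case: ifP => // _.
  by case: eqVneq => // ->.
have -> : w i.+1 = wi (v 0 i).
  apply/rowP => j; rewrite !mxE ltnS leq_eqVlt -val_eqE /=.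
  by case: (eqVneq (j : nat) i) => [/val_inj ->|]; rewrite ?ltnn.
have wir y : `|y - p0 0 i| < r -> forall j, `|wi y 0 j - p0 0 j| < r.
  move=> yr j; rewrite mxE; case: ifP => // _.
  by case: eqVneq => // ->.
have -> : F (wi (v 0 i)) - F (wi (u 0 i)) - g i * (v 0 i - u 0 i) =
  (F (wi (v 0 i)) - g i * v 0 i) - (F (wi (u 0 i)) - g i * u 0 i) by ring.
apply: (dist_le_of_derivative (fun y => F (wi y) - g i * y)
  (fun y => 'D_(delta_mx 0 i) F (wi y) - g i) (p0 0 i) r) => // y yr.
  have [Fd _] := HF (wi y) i (wir y yr).
  have ? : is_derive y 1 (fun z => F (wi z)) ('D_(delta_mx 0 i) F (wi y)).
    apply: is_derive_along => // h; apply/rowP => j; rewrite !mxE eqxx /=.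
    case: eqVneq => [->|ji]; first by rewrite ltnn mulr1.
    by rewrite mulr0 add0r.
  by apply: is_derive_eq; rewrite /GRing.scale /=; ring.
by move=> _; have [] := HF (wi y) i (wir y yr).
Qed.

Lemma row_ballP {R : realType} {m} {p q : 'rV[R]_m * R} {r : R} : 0 < r ->
  (forall i, `|q.1 0 i - p.1 0 i| < r) -> `|q.2 - p.2| < r -> ball p r q.
Proof.
move=> r0 H1 H2; split; last by rewrite /ball /= distrC.
split=> // i j; rewrite ord1 /ball /= distrC; exact: H1.
Qed.

Lemma near_side_value {R : realType} {m} {A : 'I_m -> R -> R} {X : R -> R} b
    {t r : R} :
  (forall i, cadlag (A i)) -> cadlag X -> 0 <= t -> 0 < r ->
  \forall s \near half_nbhds b t, `|X s - side_value b X t| < r /\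
    forall i, `|A i s - side_value b (A i) t| < r.
Proof.
move=> Ac Xc t0 r0; near=> s; split; near: s.
  exact: (cvg_dist_near (cadlag_cvg b Xc t0)).
apply: filter_forall => i.
exact: (cvg_dist_near (cadlag_cvg b (Ac i) t0)).
Unshelve. all: by end_near.
Qed.

(** Relative compactness in [U] keeps the left limits of the path inside [U],
    so that the function [f] is under control near them. *)
Lemma side_value_in {R : realType} {m} {U : set ('rV[R]_m * R)}
    {A : 'I_m -> R -> R} {X : R -> R} b {t T : R} :
  (forall i, cadlag (A i)) -> cadlag X -> 0 <= t <= T ->
  relatively_compact_in U
    ((fun t => (\row_i A i t, X t)) @` [set t | 0 <= t <= T]) ->
  U (\row_i side_value b (A i) t, side_value b X t).
Proof.
move=> Ac Xc /andP[t0 tT] [SU cK].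
set S := (X in X `<=` U) in SU cK.
have inS : U (\row_i A i t, X t).
  by apply: SU; exists t => //=; rewrite t0.
case: b; first exact: inS.
move: t0; rewrite le_eqVlt => /predU1P[t0|t0].
  by rewrite /side_value /left_limit -t0 ltxx t0.
have pf : ProperFilter (half_nbhds false t) by exact: half_nbhds_proper.
have Kc : closed (closure S `&` U).
  by apply: compact_closed => //; exact: norm_hausdorff.
suff : (closure S `&` U) (\row_i side_value false (A i) t, side_value false X t).
  by case.
apply: Kc; apply: (@closure_subset _ S).
  by move=> p Sp; split; [exact: subset_closure|exact: SU].
move=> B /nbhs_ballP[r /= r0 rB].
have near_r := near_side_value false Ac Xc (ltW t0) r0.
have lt_t : \forall s \near half_nbhds false t, 0 <= s <= T.
  exists 1 => //= s [s0 /andP[_ st]].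
  by rewrite s0 (le_trans (ltW st)).
have [s [[H1 H2] sT]] := filter_ex (filterI near_r lt_t).
exists (\row_i A i s, X s); split; first by exists s.
by apply: rB; apply: row_ballP => //= i; rewrite !mxE.
Qed.

(** The field is [phi s x = f (A s, x)] on a small box around the one-sided limit
    [p0] of [(A, X)], with [c] the second space derivative at [p0] and [L] the
    linear part in [A].  Values of [xi] slightly after [T] are needed on the
    right of [T], hence the horizon [T + 1]. *)
Lemma has_fields_of_admissible {R : realType} {xi X : R -> R} :
  cadlag X -> admissible_integrand xi X ->
  forall T, 0 < T -> exists2 a, increasing_path a &
    forall t, 0 <= t <= T -> has_fields X a xi t.
Proof.
move=> Xc [xic adm] T T0; have T10 : 0 < T + 1 by lra.
have [m [U [f [A [oU fC AFV xiE rc]]]]] := adm _ T10.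
have Ac i : cadlag (A i) by have [] := AFV i.
have /choice[v vP] : forall i, exists v : R -> R, increasing_path v /\
    forall s t, 0 <= s -> s <= t -> `|A i t - A i s| <= v t - v s.
  by move=> i; have [v v1 v2] := FVloc_variation (AFV i); exists v.
exists (fun t => \sum_i v i t).
  by apply: increasing_path_sum => i; have [] := vP i.
move=> t /andP[t0 tT] b.
have tT1 : 0 <= t <= T + 1 by apply/andP; split; lra.
have Up := side_value_in b Ac Xc tT1 rc.
set p0 := (_, _) in Up.
pose g i := partial_a i f p0; pose c := partial_x (partial_x f) p0.
pose M := 1 + `|partial_x f p0| + `|c| + \sum_i `|g i|.
have sg0 : 0 <= \sum_i `|g i| by apply: sumr_ge0.
have gM i : `|g i| <= M.
  rewrite /M (bigD1 i)//=; set S := \sum_(_ | _) _.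
  have S0 : 0 <= S by apply: sumr_ge0.
  have := normr_ge0 c; have := normr_ge0 (partial_x f p0).
  by move: S0; clear; lra.
have M0 : 0 <= M by rewrite /M !addr_ge0.
exists M => // e e0.
have [r0 /= r00 Hr0] : exists2 r, 0 < r & ball p0 r `<=` [set p | [/\ U p,
    `|partial_x f p - partial_x f p0| < 1,
    `|partial_x (partial_x f) p - c| < e &
    forall i, `|partial_a i f p - g i| < e]].
  apply/nbhs_ballP; have [ca _ cx _ cxx] := fC p0 Up.
  near=> p; split.
  - by near: p; exact: open_nbhs_nbhs.
  - by near: p; exact: (cvg_dist_near cx).
  - by near: p; exact: (cvg_dist_near cxx).
  - near: p; apply: filter_forall => i; have [_ cai] := ca i.
    exact: (cvg_dist_near cai).
pose r := Num.min r0 e.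
have rr0 : r <= r0 by rewrite ge_min lexx.
have r_gt0 : 0 < r by rewrite lt_min r00.
have inball (w : 'rV[R]_m) x : (forall i, `|w 0 i - p0.1 0 i| < r) ->
    `|x - p0.2| < r -> ball p0 r0 (w, x).
  move=> wr xr; apply: row_ballP => //= [i|].
    exact: lt_le_trans (wr i) rr0.
  exact: lt_le_trans xr rr0.
have [d1 /= d10 Hd1] := near_side_value b Ac Xc t0 r_gt0.
pose d := Num.min d1 1.
have d0 : 0 < d by rewrite lt_min d10 ltr01.
exists d => //.
have inI s : half_nbhd b t d s -> [/\ 0 <= s <= T + 1, `|X s - p0.2| < r &
    forall i, `|(\row_i A i s : 'rV[R]_m) 0 i - p0.1 0 i| < r].
  move=> Is; have [] := Hd1 s (half_nbhd_le (_ : d <= d1) s Is).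
    by rewrite ge_min lexx.
  move=> H1 H2; split => //; last by move=> i; rewrite !mxE.
  have d1' : d <= 1 by rewrite ge_min lexx orbT.
  have [s0 ss] := Is; rewrite s0 /=.
  by case: b ss {Up p0 Is Hd1 H1 H2 g c M sg0 gM M0 Hr0 inball} => /andP[? ?]; lra.
pose w s : 'rV[R]_m := \row_i A i s.
have inb s x (Is : half_nbhd b t d s) (xr : `|x - p0.2| < r) : ball p0 r0 (w s, x).
  by have [_ _ wr] := inI s Is; exact: inball.
exists (fun s x => f (w s, x)), (fun s x => partial_x f (w s, x)), r.
exists (fun s => \sum_i g i * A i s), c.
split.
- by rewrite r_gt0 ge_min lexx orbT.
- by move=> s /inI[].
- move=> s x Is xr; have [Uq _ _ _] := Hr0 _ (inb s x Is xr).
  have [_ fx _ _ _] := fC _ Uq.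
  by rewrite /partial_x derive1E; exact: DeriveDef.
- by move=> s /inI[sT _ _]; rewrite xiE.
- rewrite /M; have := normr_ge0 (partial_x f p0); move: sg0; clear; lra.
- move=> s x Is xr; have [_ Hx _ _] := Hr0 _ (inb s x Is xr).
  have := lerB_dist (partial_x f (w s, x)) (partial_x f p0).
  rewrite /M; have := normr_ge0 c; move: Hx sg0; clear; lra.
- move=> s x y Is xr yr.
  have -> : partial_x f (w s, y) - partial_x f (w s, x) - c * (y - x) =
    (partial_x f (w s, y) - c * y) - (partial_x f (w s, x) - c * x) by ring.
  apply: (dist_le_of_derivative (fun z => partial_x f (w s, z) - c * z)
    (fun z => partial_x (partial_x f) (w s, z) - c) p0.2 r) => // z zr.
    have [Uq _ _ _] := Hr0 _ (inb s z Is zr).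
    have [_ _ _ fx _] := fC _ Uq.
    have ? : is_derive z 1 (fun z => partial_x f (w s, z))
        (partial_x (partial_x f) (w s, z)).
      by rewrite [X in is_derive _ _ _ X]/partial_x derive1E; exact: DeriveDef.
    by apply: is_derive_eq; rewrite /GRing.scale /=; ring.
  by move=> _; have [_ _ Hx _] := Hr0 _ (inb s z Is zr); exact: ltW.
- move=> s u x Is Iu su xr.
  have [_ _ ws] := inI s Is; have [_ _ wu] := inI u Iu.
  have HF (q : 'rV[R]_m) i : (forall j, `|q 0 j - p0.1 0 j| < r) ->
      derivable (fun q => f (q, x)) q (delta_mx 0 i) /\
      `|'D_(delta_mx 0 i) (fun q => f (q, x)) q - g i| <= e.
    move=> qr; have [Uq _ _ Hq] := Hr0 _ (inball q x qr xr).
    have [fa _ _ _ _] := fC _ Uq.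
    by split; [have [] := fa i|exact/ltW/Hq].
  have := increment_partials HF ws wu.
  have -> : \sum_i g i * A i u - \sum_i g i * A i s =
      \sum_i g i * (w u 0 i - w s 0 i).
    by rewrite -sumrB; apply: eq_bigr => i _; rewrite !mxE mulrBr.
  move=> /le_trans; apply.
  rewrite ler_wpM2l ?(ltW e0)// -sumrB; apply: ler_sum => i _.
  by rewrite !mxE; apply: (vP i).2 => //; have [] := Is.
- move=> s u Is Iu su; rewrite -!sumrB mulr_sumr.
  apply: le_trans (ler_norm_sum _ _ _) _; apply: ler_sum => i _.
  rewrite -mulrBr normrM ler_pM//.
  by apply: (vP i).2 => //; have [] := Is.
Unshelve. all: by end_near.
Qed.

(** * Integration by parts *)

Theorem corollary2p25 (R : realType) (Pi : nat -> nat -> R)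
    (hPi : forall n, is_partition (Pi n))
    (hmesh : mesh (Pi n) @[n --> \oo] --> 0%E)
    (X : R -> R) (hX : QV Pi X)
    (xi eta : R -> R)
    (hxi : admissible_integrand xi X) (heta : admissible_integrand eta X)
    (A B : R -> R) (hA : FVloc A) (hB : FVloc B)
    (Y Z : R -> R)
    (hY : forall t : R, 0 <= t -> Y t = ito_integral Pi xi X t + A t)
    (hZ : forall t : R, 0 <= t -> Z t = ito_integral Pi eta X t + B t) :
  QVd Pi (tnth [tuple Y; Z]) /\
  forall t : R, 0 <= t ->
    [/\ ito_integral_exists Pi Y Z t,
        ito_integral_exists Pi Z Y t
      & Y t * Z t - Y 0 * Z 0 =
        ito_integral Pi Y Z t + ito_integral Pi Z Y t + covariation Pi Y Z t].
Proof.
have [Xc _ _ _ _] := hX.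
pose good (V zeta : R -> R) := cadlag V /\ cadlag zeta /\
  forall T, 0 < T -> exists2 a, increasing_path a &
    forall t, 0 <= t <= T -> has_path_fields X a V zeta t.
have pathF (zeta C V : R -> R) : admissible_integrand zeta X -> FVloc C ->
    (forall t, 0 <= t -> V t = ito_integral Pi zeta X t + C t) -> good V zeta.
  move=> hz hC hV; have [zc _] := hz.
  have F := has_fields_of_admissible Xc hz.
  have reg : ito_regular Pi zeta X.
    apply: (ito_regular_local Pi X) => // T T0; have [a ha H] := F T T0.
    by exists a => // t /H; exact: locally_approx_of_fields.
  split.
    have [_ Ic _] := reg; have [cc _] := cadlag_add Ic hC.1.
    by apply: cadlag_ext cc => t t0; rewrite hV.
  split => // T T0; have [a ha H] := F T T0.
  have [v hv vC] := FVloc_variation hC.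
  exists (a \+ bracket Pi X \+ v).
    apply: increasing_pathD => //; apply: increasing_pathD => //.
    exact: bracket_increasing.
  move=> t /H; exact: (has_path_fields_of_integral Pi C).
have goodY := pathF _ _ _ hxi hA hY; have goodZ := pathF _ _ _ heta hB hZ.
have reg (V W zeta theta : R -> R) : good V zeta -> good W theta ->
    ito_regular Pi V W.
  move=> [Vc [zc HV]] [Wc [tc HW]]; apply: (ito_regular_local Pi X) => // T T0.
  have [a ha Ha] := HV T T0; have [a' ha' Ha'] := HW T T0.
  exists (a \+ a'); first exact: increasing_pathD.
  move=> t tT; have /andP[t0 _] := tT.
  apply: (locally_approx_of_path_fields zeta theta) => //.
  - exact: increasing_pathD.
  - by apply: has_path_fields_le => //; exact: Ha.
  - have -> : a \+ a' = a' \+ a by apply/funext => s /=; rewrite addrC.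
    by apply: has_path_fields_le => //; exact: Ha'.
have Yc := goodY.1; have Zc := goodZ.1.
pose V (i : 'I_2) := tnth [tuple Y; Z] i.
have Vc i : cadlag (V i).
  by rewrite /V (tnth_nth Y); case: i => -[|[|//]] i.
have Vreg i j : ito_regular Pi (V i) (V j).
  rewrite /V !(tnth_nth Y); case: i => -[|[|k]] ik /=; last by have := ik.
    by case: j => -[|[|l]] jl /=; [exact: (reg _ _ _ _ goodY goodY)|
      exact: (reg _ _ _ _ goodY goodZ)|have := jl].
  by case: j => -[|[|l]] jl /=; [exact: (reg _ _ _ _ goodZ goodY)|
    exact: (reg _ _ _ _ goodZ goodZ)|have := jl].
have VW i j k : ito_regular Pi (V k) (V i \+ V j) /\
  forall t, 0 <= t -> ito_integral Pi (V k) (V i \+ V j) t =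
    ito_integral Pi (V k) (V i) t + ito_integral Pi (V k) (V j) t.
  exact: ito_regularDr.
have VV i j : ito_regular Pi (V i \+ V j) (V i \+ V j) /\
  forall t, 0 <= t -> ito_integral Pi (V i \+ V j) (V i \+ V j) t =
    ito_integral Pi (V i) (V i \+ V j) t + ito_integral Pi (V j) (V i \+ V j) t.
  by apply: ito_regularDl => //; [exact: (VW i j i).1|exact: (VW i j j).1].
have Vcc i j : cadlag (V i \+ V j) by have [] := cadlag_add (Vc i) (Vc j).
split.
  split=> // i j.
  by have [] := QV_of_ito_regular hPi hmesh (Vcc i j) (VV i j).1.
move=> t t0; have regYZ := reg _ _ _ _ goodY goodZ.
have regZY := reg _ _ _ _ goodZ goodY.
split; [by have [+ _ _] := regYZ; exact|by have [+ _ _] := regZY; exact|].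
have [_ bY] := QV_of_ito_regular hPi hmesh Yc (reg _ _ _ _ goodY goodY).
have [_ bZ] := QV_of_ito_regular hPi hmesh Zc (reg _ _ _ _ goodZ goodZ).
pose i0 : 'I_2 := ord0; pose i1 : 'I_2 := lift ord0 ord0.
have [_ bYZ] := QV_of_ito_regular hPi hmesh (Vcc i0 i1) (VV i0 i1).1.
have := bYZ t t0; rewrite (VV i0 i1).2// (VW i0 i1 i0).2// (VW i0 i1 i1).2//.
rewrite /V /i0 /i1 !(tnth_nth Y) /= => E.
by rewrite /covariation E bY// bZ//; field.
Qed.
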